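(* Let $R$ be a ring with enough idempotents. Let $\kappa$ be a singular cardinal, $M$ a $\kappa$-presented module, and $\mathcal D$ a class of modules. Let $\nu<\kappa$ be an infinite cardinal. (a) Assume that $\mathcal D$ is filter-closed and that, for every successor cardinal $\lambda$ with $\nu<\lambda<\kappa$, the module $M$ is almost $(\mathcal D,\lambda)$-projective. Then $\operatorname{Ext}^1_R(M,D)=0$ for all $D\in\mathcal D$. (b) Assume that, for every successor cardinal $\lambda$ with $\nu<\lambda<\kappa$, the module $M$ is $(\mathcal D,\lambda)$-projective. Then $\operatorname{Ext}^1_R(M,D)=0$ for all $D\in\mathcal D$ (regardless of whether $\mathcal D$ is filter-closed).
   Context: For an associative ring $R$ with enough idempotents (possibly non-unital), modules are unitary right $R$-modules $M$, i.e. $MR=M$. A module is $\kappa$-presented (resp. $<\lambda$-presented) if it is the cokernel of a homomorphism between two direct sums of at most $\kappa$ (resp. fewer than $\lambda$) modules of the form $eR$ with $e\in R$ idempotent. For a class $\mathcal D$, ${}^\perp\mathcal D=\{N:\operatorname{Ext}^1_R(N,D)=0\ \forall D\in\mathcal D\}$. A homomorphism $f\colon A\to B$ is $\mathcal D$-injective if $\operatorname{Hom}_R(f,D)\colon\operatorname{Hom}_R(B,D)\to\operatorname{Hom}_R(A,D)$ is surjective for all $D\in\mathcal D$. For a regular uncountable cardinal $\lambda$, a directed system $(M_i,f_{ji}\colon M_i\to M_j\mid i<j\in I)$ is $\lambda$-continuous if the poset $(I,\le)$ has suprema of all chains of length $<\lambda$ and, for any such chain $J\subseteq I$, $M_{\sup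 J}=\varinjlim_{j\in J}M_j$. A module $M$ is almost $(\mathcal D,\lambda)$-projective if it is the direct limit of a $\lambda$-continuous directed system consisting of $<\lambda$-presented modules from ${}^\perp\mathcal D$; it is $(\mathcal D,\lambda)$-projective if moreover the system can be chosen so that all the colimit maps (from its members to $M$) are $\mathcal D$-injective. A nonempty class $\mathcal D$ of modules is filter-closed if, for every set $X$, every (not necessarily proper) filter $\mathfrak F$ of subsets of $X$ and every family $(D_x\mid x\in X)$ of modules from $\mathcal D$, the submodule $\{(d_x)_{x}\in\prod_{x\in X}D_x \mid \{x\in X: d_x=0\}\in\mathfrak F\}$ of the product belongs to $\mathcal D$. *)

(* Defs.v *)
From HB Require Import structures.
From mathcomp Require Import all_boot all_order all_algebra.
From mathcomp Require Import boolp classical_sets functions cardinality filter.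
From mathcomp Require Import wochoice.

Set Implicit Arguments.
Unset Strict Implicit.
Unset Printing Implicit Defensive.

Import Order.TTheory GRing.Theory.
Local Open Scope classical_set_scope.
Local Open Scope card_scope.
Local Open Scope ring_scope.

(* A cardinal is represented by any type of that cardinality. *)

Definition card_lt (A B : Type) : Prop :=
  ([set: A] #<= [set: B]) /\ ~ ([set: B] #<= [set: A]).

(* A well-order whose order type is the initial ordinal of |K|. *)
Definition initial_well_order (K : Type) (r : rel K) : Prop :=
  well_order r /\ forall x, card_lt {y : K | r y x /\ y <> x} K.

Definition cofinal_in (K : Type) (r : rel K) (C : set K) : Prop :=
  forall x, exists2 c, C c & r x c.

(* Infinite with cf K < K. *)
Definition singular (K : Type) : Prop :=
  infinite_set [set: K] /\
  exists r : rel K, initial_well_order r /\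
    exists C : set K, cofinal_in r C /\ card_lt {c : K | C c} K.

Definition successor_cardinal (L : Type) : Prop :=
  exists P : Type, card_lt P L /\
    forall Q : Type, card_lt Q L -> [set: Q] #<= [set: P].

HB.mixin Record Zmodule_isRng R of GRing.Zmodule R := {
  rng_mul : R -> R -> R;
  rng_mulA : associative rng_mul;
  rng_mulDl : left_distributive rng_mul +%R;
  rng_mulDr : right_distributive rng_mul +%R
}.

#[short(type="rngType")]
HB.structure Definition Rng := {R of Zmodule_isRng R & GRing.Zmodule R}.

Reserved Notation "a ** b" (at level 40, left associativity).
Notation "a ** b" := (rng_mul a b) : ring_scope.

Definition idempotent_elt (R : rngType) (e : R) : Prop := e ** e = e.

(* V is the (internal) direct sum of the subsets A e, e in E; the A e are
   meant to be subgroups. *)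
Definition internal_direct_sum (V : zmodType) (I : choiceType) (E : set I)
    (A : I -> set V) : Prop :=
  (forall x : V, exists (s : seq I) (u : I -> V),
     [/\ uniq s, {in s, forall e, E e /\ A e (u e)} & x = \sum_(e <- s) u e]) /\
  (forall (s : seq I) (u : I -> V),
     uniq s -> {in s, forall e, E e /\ A e (u e)} -> \sum_(e <- s) u e = 0 ->
     {in s, forall e, u e = 0}).

Definition enough_idempotents (R : rngType) : Prop :=
  exists E : set R,
    [/\ forall e, E e -> idempotent_elt e,
        forall e f, E e -> E f -> e <> f -> e ** f = 0,
        internal_direct_sum E (fun e => [set x | exists r : R, x = e ** r])
      & internal_direct_sum E (fun e => [set x | exists r : R, x = r ** e])].

(* Right modules, not necessarily unitary: MR = M is the predicate [unitary]
   below. *)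
HB.mixin Record Zmodule_isRmodule (R : rngType) M of GRing.Zmodule M := {
  rmod_act : M -> R -> M;
  rmod_actA : forall x (a b : R),
    rmod_act (rmod_act x a) b = rmod_act x (a ** b);
  rmod_actDl : forall x y (a : R),
    rmod_act (x + y) a = rmod_act x a + rmod_act y a;
  rmod_actDr : forall x (a b : R),
    rmod_act x (a + b) = rmod_act x a + rmod_act x b
}.

#[short(type="rmodType")]
HB.structure Definition Rmodule (R : rngType) :=
  {M of Zmodule_isRmodule R M & GRing.Zmodule M}.

Reserved Notation "x *> a" (at level 40, left associativity).
Notation "x *> a" := (rmod_act x a) : ring_scope.

Section ModuleTheory.
Variables (R : rngType) (M : rmodType R).
Implicit Types (x y : M) (a : R).

Lemma rmod_act0 a : (0 : M) *> a = 0.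
Proof. by apply: (addrI ((0 : M) *> a)); rewrite -rmod_actDl !addr0. Qed.

Lemma rmod_actN x a : (- x) *> a = - (x *> a).
Proof. by apply: (addIr (x *> a)); rewrite -rmod_actDl !addNr rmod_act0. Qed.

Lemma rmod_actB x y a : (x - y) *> a = x *> a - y *> a.
Proof. by rewrite rmod_actDl rmod_actN. Qed.

(* MR, the set of finite sums of products x *> a. *)
Definition unitary_part : set M :=
  [set x | exists s : seq (M * R), x = \sum_(p <- s) p.1 *> p.2].

Definition unitary : Prop := forall x, unitary_part x.

End ModuleTheory.
Arguments unitary {R} M.
Arguments unitary_part {R} M.

Definition rhom (R : rngType) (A B : rmodType R) (f : A -> B) : Prop :=
  {morph f : x y / x + y} /\ forall a : R, {morph f : x / x *> a}.

Record submodule (R : rngType) (M : rmodType R) := Submodule {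
  submodule_set : set M;
  submodule0 : submodule_set 0;
  submoduleB : forall x y,
    submodule_set x -> submodule_set y -> submodule_set (x - y);
  submodule_act : forall x (a : R), submodule_set x -> submodule_set (x *> a)
}.

Section SubmoduleAsModule.
Variables (R : rngType) (M : rmodType R) (S : submodule M).

Definition submod_pred : {pred M} := [pred x | `[< submodule_set S x >]].

Record submod_of := SubmodOf {
  submod_val : M;
  submod_valP : submod_val \in submod_pred
}.

HB.instance Definition _ := [isSub for submod_val].
HB.instance Definition _ := [Choice of submod_of by <:].

Lemma submod_zmod_closed : zmod_closed submod_pred.
Proof.
split; first exact/asboolP/submodule0.
by move=> x y /asboolP Sx /asboolP Sy; apply/asboolP/submoduleB.
Qed.

HB.instance Definition _ :=
  GRing.isZmodClosed.Build M submod_pred submod_zmod_closed.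
HB.instance Definition _ := [SubChoice_isSubZmodule of submod_of by <:].

Lemma submod_act_subproof (x : submod_of) (a : R) :
  submod_val x *> a \in submod_pred.
Proof. by apply/asboolP/submodule_act/asboolP/(submod_valP x). Qed.

Definition submod_act (x : submod_of) (a : R) : submod_of :=
  SubmodOf (submod_act_subproof x a).

Fact submod_actA x a b :
  submod_act (submod_act x a) b = submod_act x (a ** b).
Proof. by apply: val_inj; rewrite /= rmod_actA. Qed.

Fact submod_actDl x y a :
  submod_act (x + y) a = submod_act x a + submod_act y a.
Proof. by apply: val_inj; rewrite /= rmod_actDl. Qed.

Fact submod_actDr x a b :
  submod_act x (a + b) = submod_act x a + submod_act x b.
Proof. by apply: val_inj; rewrite /= rmod_actDr. Qed.

HB.instance Definition _ := Zmodule_isRmodule.Build R submod_of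
  submod_actA submod_actDl submod_actDr.

Definition submod : rmodType R := submod_of.

End SubmoduleAsModule.

Definition regular (R : rngType) : Type := R.
HB.instance Definition _ (R : rngType) := GRing.Zmodule.on (regular R).
HB.instance Definition _ (R : rngType) := Zmodule_isRmodule.Build R (regular R)
  (fun x a b => esym (rng_mulA (x : R) a b)) (@rng_mulDl R) (@rng_mulDr R).

Section PrincipalModule.
Variables (R : rngType) (e : R).

Definition principal_set : set (regular R) := [set x | exists r : R, x = e ** r].

Fact principal0 : principal_set 0.
Proof.
exists 0; apply: (addrI (e ** 0)).
by rewrite -rng_mulDr addr0 addr0.
Qed.

Fact principalB x y :
  principal_set x -> principal_set y -> principal_set (x - y).
Proof.
move=> [a ->] [b ->]; exists (a - b); apply: (addIr (e ** b)).
by rewrite -rng_mulDr !subrK.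
Qed.

Fact principal_act (x : regular R) (a : R) :
  principal_set x -> principal_set (x *> a).
Proof. by move=> [r ->]; exists (r ** a); exact: esym (rng_mulA e r a). Qed.

Definition principal : rmodType R :=
  submod (Submodule principal0 principalB principal_act).

End PrincipalModule.

Section Product.
Variables (R : rngType) (I : Type) (A : I -> rmodType R).

Definition dprod : Type := forall i, A i.

HB.instance Definition _ := gen_eqMixin dprod.
HB.instance Definition _ := gen_choiceMixin dprod.

Fact dprod_addA :
  associative (fun (x y : dprod) => (fun i => x i + y i) : dprod).
Proof. by move=> x y z; apply: functional_extensionality_dep => i; rewrite addrA. Qed.

Fact dprod_addC :
  commutative (fun (x y : dprod) => (fun i => x i + y i) : dprod).
Proof. by move=> x y; apply: functional_extensionality_dep => i; rewrite addrC. Qed.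

Fact dprod_add0 : left_id ((fun i => 0) : dprod)
  (fun (x y : dprod) => (fun i => x i + y i) : dprod).
Proof. by move=> x; apply: functional_extensionality_dep => i; rewrite add0r. Qed.

Fact dprod_addN : left_inverse ((fun i => 0) : dprod)
  (fun x : dprod => (fun i => - x i) : dprod)
  (fun (x y : dprod) => (fun i => x i + y i) : dprod).
Proof. by move=> x; apply: functional_extensionality_dep => i; rewrite addNr. Qed.

HB.instance Definition _ := GRing.isZmodule.Build dprod
  dprod_addA dprod_addC dprod_add0 dprod_addN.

Definition dprod_act (x : dprod) (a : R) : dprod := fun i => x i *> a.

Fact dprod_actA x a b : dprod_act (dprod_act x a) b = dprod_act x (a ** b).
Proof. by apply: functional_extensionality_dep => i; rewrite /dprod_act rmod_actA. Qed.

Fact dprod_actDl x y a :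
  dprod_act (x + y) a = dprod_act x a + dprod_act y a.
Proof. by apply: functional_extensionality_dep => i; rewrite /dprod_act rmod_actDl. Qed.

Fact dprod_actDr x a b :
  dprod_act x (a + b) = dprod_act x a + dprod_act x b.
Proof. by apply: functional_extensionality_dep => i; rewrite /dprod_act rmod_actDr. Qed.

HB.instance Definition _ := Zmodule_isRmodule.Build R dprod
  dprod_actA dprod_actDl dprod_actDr.

Definition dsum_set : set dprod := [set x | finite_set [set i | x i <> 0]].

Fact dsum0 : dsum_set 0.
Proof.
rewrite /dsum_set /=; have -> : [set i | (0 : dprod) i <> 0] = set0.
  by apply/seteqP; split.
exact: finite_set0.
Qed.

Fact dsumB x y : dsum_set x -> dsum_set y -> dsum_set (x - y).
Proof.
move=> fx fy; apply: (@sub_finite_set _ _ ([set i | x i <> 0] `|` [set i | y i <> 0])).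
  move=> i /=; apply: contra_notP => /not_orP[/contrapT xi /contrapT yi].
  by rewrite [LHS](_ : _ = x i - y i) // xi yi subr0.
by rewrite finite_setU.
Qed.

Fact dsum_act (x : dprod) (a : R) : dsum_set x -> dsum_set (x *> a).
Proof.
apply: sub_finite_set => i /=; apply: contra_not => xi.
by rewrite [LHS](_ : _ = x i *> a) // xi rmod_act0.
Qed.

Definition dsum : rmodType R := submod (Submodule dsum0 dsumB dsum_act).

End Product.

(* M is the cokernel, via p, of a morphism h between direct sums of modules eR;
   [small] bounds the number of summands. *)
Definition presented (small : Type -> Prop) (R : rngType) (M : rmodType R) : Prop :=
  exists (I J : Type) (e : I -> R) (f : J -> R),
    [/\ small I, small J, forall i, idempotent_elt (e i)
      & forall j, idempotent_elt (f j)] /\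
  exists (h : dsum (fun j => principal (f j)) -> dsum (fun i => principal (e i)))
         (p : dsum (fun i => principal (e i)) -> M),
    [/\ rhom h, rhom p, (forall y, exists x, p x = y)
      & forall x, p x = 0 <-> exists z, h z = x].

Definition le_presented (K : Type) (R : rngType) (M : rmodType R) : Prop :=
  presented (fun I => [set: I] #<= [set: K]) M.

Definition lt_presented (L : Type) (R : rngType) (M : rmodType R) : Prop :=
  presented (fun I => card_lt I L) M.

Record extension (R : rngType) (N D : rmodType R) := Extension {
  ext_mod : rmodType R;
  ext_inj : D -> ext_mod;
  ext_proj : ext_mod -> N;
  ext_unitary : unitary ext_mod;
  ext_inj_hom : rhom ext_inj;
  ext_proj_hom : rhom ext_proj;
  ext_injective : injective ext_inj;
  ext_surjective : forall y, exists x, ext_proj x = y;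
  ext_exact : forall x, ext_proj x = 0 <-> exists d, ext_inj d = x
}.

Arguments ext_inj {R N D} e d.
Arguments ext_proj {R N D} e x.

Definition ext_equiv (R : rngType) (N D : rmodType R) (E E' : extension N D) : Prop :=
  exists phi : ext_mod E -> ext_mod E',
    [/\ rhom phi, forall d, phi (ext_inj E d) = ext_inj E' d
      & forall x, ext_proj E' (phi x) = ext_proj E x].

(* Yoneda's Ext^1(N, D) is the group of extensions of N by D up to equivalence;
   it is zero iff it has only one element. *)
Definition Ext1_eq0 (R : rngType) (N D : rmodType R) : Prop :=
  forall E E' : extension N D, ext_equiv E E'.

(* Classes of modules are predicates of type [rmodType R -> Prop]. *)
Definition left_perp (R : rngType) (DD : rmodType R -> Prop) (N : rmodType R) : Prop :=
  unitary N /\ forall D, DD D -> Ext1_eq0 N D.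

Definition D_injective (R : rngType) (DD : rmodType R -> Prop)
    (A B : rmodType R) (f : A -> B) : Prop :=
  forall D, DD D -> forall g : A -> D, rhom g ->
    exists2 h : B -> D, rhom h & forall x, h (f x) = g x.

Record dsystem (R : rngType) (d : Order.disp_t) (I : porderType d) := Dsystem {
  ds_obj :> I -> rmodType R;
  ds_map : forall i j, (i <= j)%O -> ds_obj i -> ds_obj j;
  ds_map_hom : forall i j (ij : (i <= j)%O), rhom (ds_map ij);
  ds_map_id : forall i (ii : (i <= i)%O) x, ds_map ii x = x;
  ds_map_comp : forall i j k (ij : (i <= j)%O) (jk : (j <= k)%O)
    (ik : (i <= k)%O) x, ds_map jk (ds_map ij x) = ds_map ik x
}.

Definition directed (d : Order.disp_t) (I : porderType d) : Prop :=
  [set: I] !=set0 /\ forall i j : I, exists2 k, (i <= k)%O & (j <= k)%O.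

Arguments ds_map {R d I} S {i j} ij x : rename.

Section Colimit.
Variables (R : rngType) (d : Order.disp_t) (I : porderType d).
Variables (M : dsystem R I) (J : set I).

Definition is_cocone (L : rmodType R) (c : forall j, J j -> M j -> L) : Prop :=
  (forall j (Jj : J j), rhom (c j Jj)) /\
  (forall i j (Ji : J i) (Jj : J j) (ij : (i <= j)%O) x,
     c j Jj (ds_map M ij x) = c i Ji x).

(* The universal property is tested in the category of unitary modules. *)
Definition is_colimit (L : rmodType R) (c : forall j, J j -> M j -> L) : Prop :=
  is_cocone c /\
  forall (X : rmodType R) (g : forall j, J j -> M j -> X),
    unitary X -> is_cocone g ->
    exists! h : L -> X, rhom h /\ forall j (Jj : J j) x, h (c j Jj x) = g j Jj x.

End Colimit.

(* The length of a chain is an ordinal, so chains are well-ordered here, and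
   length < L amounts to cardinality < L. For regular L, asking for all totally
   ordered subsets of cardinality < L would give the same systems, because such
   a subset has a well-ordered cofinal part. The empty chain is excluded: no
   least index is required. *)
Definition short_chain (L : Type) (d : Order.disp_t) (I : porderType d)
    (J : set I) : Prop :=
  [/\ J !=set0, wo_chain <=%O [in J] & card_lt {i : I | J i} L].

Definition continuous_system (L : Type) (R : rngType) (d : Order.disp_t)
    (I : porderType d) (M : dsystem R I) : Prop :=
  forall J : set I, short_chain L J ->
    supremums J !=set0 /\
    forall s (sJ : ubound J s), lbound (ubound J) s ->
      is_colimit (fun j (Jj : J j) => ds_map M (sJ j Jj)).

Definition almost_D_projective_system (R : rngType) (DD : rmodType R -> Prop)
    (L : Type) (M : rmodType R) (d : Order.disp_t) (I : porderType d)
    (S : dsystem R I) (c : forall i, S i -> M) : Prop :=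
  [/\ directed I, continuous_system L S,
      forall i, lt_presented L (S i) /\ left_perp DD (S i)
    & is_colimit (J := setT) (fun i _ => c i)].

Definition almost_D_projective (R : rngType) (DD : rmodType R -> Prop) (L : Type)
    (M : rmodType R) : Prop :=
  exists (d : Order.disp_t) (I : porderType d) (S : dsystem R I)
    (c : forall i, S i -> M), almost_D_projective_system DD L c.

Definition D_projective (R : rngType) (DD : rmodType R -> Prop) (L : Type)
    (M : rmodType R) : Prop :=
  exists (d : Order.disp_t) (I : porderType d) (S : dsystem R I)
    (c : forall i, S i -> M),
    almost_D_projective_system DD L c /\ forall i, D_injective DD (c i).

Section FilterProduct.
Variables (R : rngType) (X : Type) (A : X -> rmodType R).
Variables (F : set_system X) (FF : Filter F).

(* The cartesian product P need not be unitary: the product in the category of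
   unitary modules is PR, which is P when R has a unit. *)
Definition filter_prod_set : set (dprod A) :=
  [set d | unitary_part (dprod A) d /\ F [set x | d x = 0]].

Fact filter_prod0 : filter_prod_set 0.
Proof.
split; first by exists [::]; rewrite big_nil.
by apply: filterS filterT => x _.
Qed.

Fact filter_prodB u v :
  filter_prod_set u -> filter_prod_set v -> filter_prod_set (u - v).
Proof.
move=> [[s ->] Fu] [[t ->] Fv]; split.
  exists (s ++ [seq (- p.1, p.2) | p <- t]).
  rewrite big_cat big_map /=; congr (_ + _); rewrite -sumrN.
  by apply: eq_bigr => p _; rewrite rmod_actN.
apply: filterS (filterI Fu Fv) => x [/= ux vx].
by rewrite [LHS](_ : _ = (\sum_(p <- s) p.1 *> p.2 : dprod A) x
  - (\sum_(p <- t) p.1 *> p.2 : dprod A) x) // ux vx subr0.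
Qed.

Fact filter_prod_act (u : dprod A) (a : R) :
  filter_prod_set u -> filter_prod_set (u *> a).
Proof.
move=> [_ Fu]; split; first by exists [:: (u, a)]; rewrite big_seq1.
apply: filterS Fu => x /= ux.
by rewrite [LHS](_ : _ = u x *> a) // ux rmod_act0.
Qed.

Definition filter_prod : rmodType R :=
  submod (Submodule filter_prod0 filter_prodB filter_prod_act).

End FilterProduct.

(* The class [Filter] allows the improper filter. *)
Definition filter_closed (R : rngType) (DD : rmodType R -> Prop) : Prop :=
  (exists D, DD D) /\
  forall (X : Type) (F : set_system X) (FF : Filter F) (A : X -> rmodType R),
    (forall x, DD (A x)) -> DD (filter_prod A FF).

(* Main.v *)
(* Generators and relations of M are indexed by a set Z of size at most K, and a
   subset P of Z presents a module M(P).  The modules M(P) depend strictly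
   functorially on P and continuously on chains, so the systems are only used to
   find P for which M(P) is a member of a system: alternating between subsets of
   Z and stages of the system, the union P of an omega-chain has M(P) isomorphic
   to a stage.  If Z is the union of a continuous well-ordered chain of P_a such
   that M(P_a) is in the left Ext-orthogonal of DD and M(P_b) -> M(P_a) is
   DD-injective for b < a, a section of a given extension of M is built by
   recursion along the chain.  Such a chain, with |P_a| = kappa_a for a
   continuous cofinal sequence of cardinals kappa_a, is the union of omega many
   approximations P_a^n chosen simultaneously for all a (singular compactness).

   In (b) each M(P_a) is a stage of a system, hence DD-injects into M and so into
   every M(P_c).  In (a) the P_a^n are chosen strong, that is, DD-injecting into
   every larger set of the same size.  For Q = P_a^(n+1) the vanishing of Ext of
   M(Q) with values in filter products of DD shows that every P inside Q closed
   under a suitable operation DD-injects into Q relative to P_a^n; closing the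
   P_b^n, b < a, under these operations makes M(P_b) -> M(P_a) DD-injective. *)

From HB Require Import structures.
Require Import Defs.
From mathcomp Require Import all_boot all_order all_algebra.
From mathcomp Require Import boolp classical_sets functions cardinality filter.
From mathcomp Require Import wochoice.

Set Implicit Arguments.
Unset Strict Implicit.
Unset Printing Implicit Defensive.

Import Order.TTheory GRing.Theory.
Local Open Scope classical_set_scope.
Local Open Scope card_scope.

(** * Well-founded recursion and cardinal arithmetic *)

(** The module M(P) is never formed. A homomorphism from it to [A] is a function on the generators,
    read only on P, that satisfies [model P]. Ext-vanishing and DD-injectivity become the extension
    properties [lifts] and [dinj] of such functions, and passing to unions of sets amounts to gluing
    functions. Sets of size kappa_a are found in a system for the successor of kappa_a, which is
    continuous along chains of length kappa_a; a singular kappa is a limit cardinal, so these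
    successors lie below kappa. In (a) the maps from the stages to M are not known to be
    DD-injective, and strong sets of size kappa_a take two systems, for the first and the second
    successor of kappa_a: a chain of counterexamples of length kappa_a^+ has a union of size up to
    kappa_a^+, and it is the second system that makes this union lift. *)

Definition strict_wo (T : Type) (lt : T -> T -> Prop) : Prop :=
  [/\ well_founded lt, forall x y z, lt x y -> lt y z -> lt x z
    & forall x y, [\/ lt x y, x = y | lt y x]].

Lemma strict_wo_irr (T : Type) (lt : T -> T -> Prop) x :
  strict_wo lt -> ~ lt x x.
Proof. case=> wf _ _; move: x; apply: (well_founded_ind wf) => x IH xx; exact: (IH x xx xx). Qed.

Lemma strict_wo_min (T : Type) (lt : T -> T -> Prop) (A : set T) :
  well_founded lt -> A !=set0 -> exists2 m, A m & forall x, A x -> ~ lt x m.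
Proof.
move=> wf [x Ax]; apply: contrapT => noA.
suff: forall x, ~ A x by move/(_ x).
apply: (well_founded_ind wf) => {Ax}x IH Ax.
by apply: noA; exists x => // y Ay xy; exact: IH xy Ay.
Qed.

(** Everything is read off from least elements: totality and antisymmetry from sets of two elements,
    transitivity from sets of three, well-foundedness from the set of inaccessible points. *)
Lemma well_order_strict_wo (T : Type) (r : rel T) :
  well_order r -> strict_wo (fun x y => r x y /\ x <> y).
Proof.
move=> wo.
have minP (A : set T) : A !=set0 -> exists2 z, A z & forall x, A x -> r z x.
  move=> [a Aa]; have [|z [[zA lb] _]] := wo [pred x | `[< A x >]].
    by exists a; apply/asboolP.
  by exists z; [exact/asboolP | move=> x Ax; exact/lb/asboolP].
have tot x y : r x y \/ r y x.
  have [|z [->|->] h] := minP [set x; y]; first by exists x; left.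
    by left; apply: h; right.
  by right; apply: h; left.
have refl x : r x x by case: (tot x x).
have anti x y : r x y -> r y x -> x = y.
  move=> xy yx; have [|z [_ uz]] := wo [pred t | `[< t = x \/ t = y >]].
    by exists x; apply/asboolP; left.
  suff h t : t = x \/ t = y -> z = t.
    by rewrite -(h x (or_introl erefl)) (h y (or_intror erefl)).
  by move=> h; apply: uz; split=> [|t' /asboolP]; [exact/asboolP|move: h => [->|->] [->|->]].
have trans x y z : r x y -> r y z -> r x z.
  move=> xy yz; have [|t [->|[->|->]] h] := minP [set t | t = x \/ t = y \/ t = z].
  - by exists x; left.
  - by apply: h; right; right.
  - by rewrite (anti x y xy (h _ _)) //; left.
  - have zx := h _ (or_introl erefl).
    have zy := h _ (or_intror (or_introl erefl)).
    by rewrite -(anti _ _ yz zy).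
split.
- move=> x; apply: contrapT => nA.
  have [m nAm h] := minP [set x | ~ Acc (fun x y => r x y /\ x <> y) x] (ex_intro _ x nA).
  apply: nAm; constructor=> y [ym neq]; apply: contrapT => nAy.
  by apply: neq; apply: anti => //; exact: h.
- move=> x y z [xy neq] [yz neq']; split; first exact: trans xy yz.
  by move=> xz; move: yz; rewrite -xz => yx; apply: neq; exact: anti.
- move=> x y; case: (pselect (x = y)) => [->|neq]; first by constructor 2.
  by case: (tot x y) => h; [constructor 1|constructor 3; split=> // /esym].
Qed.

Lemma exists_strict_wo (T : Type) : exists lt : T -> T -> Prop, strict_wo lt.
Proof.
have [r /well_order_strict_wo wo] := well_ordering_principle {classic T}.
by eexists; exact: wo.
Qed.

(* Dependent choice along a well-founded relation: [good x f t] may only depend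
   on the values of [f] below [x]. *)
Lemma wf_dependent_choice (L T : Type) (lt : L -> L -> Prop)
    (good : L -> (L -> T) -> T -> Prop) :
  well_founded lt -> inhabited T ->
  (forall x f g t, (forall y, lt y x -> f y = g y) -> good x f t -> good x g t) ->
  (forall x f, (forall y, lt y x -> good y f (f y)) -> exists t, good x f t) ->
  exists f : L -> T, forall x, good x f (f x).
Proof.
move=> wf [t0] ext ex.
pose step x (f : forall y, lt y x -> T) : T :=
  let f' y := if pselect (lt y x) is left h then f y h else t0 in
  @xget {classic T} t0 [set t | good x f' t].
pose f := Fix wf (fun=> T) step.
have fE x : f x = @xget {classic T} t0
    [set t | good x (fun y => if pselect (lt y x) is left _ then f y else t0) t].
  rewrite /f Fix_eq // => y g h gh; congr (step y _).
  by apply: functional_extensionality_dep => z; apply: functional_extensionality_dep => ?.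
exists f; apply: (well_founded_ind wf) => x IH.
have [t gt] := ex x f IH; rewrite fE.
have cut y : lt y x -> f y = if pselect (lt y x) is left _ then f y else t0.
  by case: pselect.
apply: (ext _ _ _ _ _ (@xgetPex {classic T} _ _ _)) => [y yx|]; first by rewrite -cut.
by exists t; exact: ext gt.
Qed.

(** Injections are given as relations, so that [U] may be empty and no value has to be chosen
    outside [A]. *)
Lemma card_le_rel (T U : Type) (A : set T) (B : set U) (r : T -> U -> Prop) :
  (forall x, A x -> exists2 y, B y & r x y) ->
  (forall x x' y, A x -> A x' -> r x y -> r x' y -> x = x') -> A #<= B.
Proof.
move=> tot inj.
have tot' (x : A) : exists y : B, r (val x) (val y).
  have [y By rxy] := tot _ (set_valP x).
  by exists (SigSub (mem_set By)).
have [f fP] := choice tot'.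
apply/card_leP/injfunPex; exists f => // x x' _ _ e.
apply: val_inj; apply: (inj _ _ (val (f x))) => //; try exact: set_valP.
by rewrite e.
Qed.

Lemma card_le_inj (T U : Type) (A : set T) (B : set U) : A #<= B ->
  exists f : T -> U -> Prop, [/\ forall x, A x -> exists2 y, B y & f x y,
    forall x x' y, f x y -> f x' y -> x = x' & forall x y y', f x y -> f x y' -> y = y'].
Proof.
move=> /card_leP/injfunPex[f _ finj].
exists (fun x y => exists a : A, val a = x /\ val (f a) = y); split.
- move=> x Ax; exists (val (f (SigSub (mem_set Ax)))); first exact: set_valP.
  by exists (SigSub (mem_set Ax)).
- move=> x x' y [a [<- fa]] [a' [<- fa']].
  by rewrite (finj a a' (mem_set I) (mem_set I)) //; apply: val_inj; rewrite fa fa'.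
- by move=> x y y' [a [<- <-]] [a' [/val_inj-> <-]].
Qed.

Lemma card_le_fun (T U : Type) (A : set T) (B : set U) : A #<= B -> inhabited U ->
  exists f : T -> U, (forall x, A x -> B (f x)) /\
    (forall x y, A x -> A y -> f x = f y -> x = y).
Proof.
move=> /card_le_inj[r [tot inj _]] [u0].
have h x : exists y, A x -> B y /\ r x y.
  case: (pselect (A x)) => [/tot[y By rxy]|nA]; last by exists u0.
  by exists y.
have [f fP] := choice h.
exists f; split=> [x /fP[]|x y /fP[_ rx] /fP[_ ry] e] //.
by apply: inj rx _; rewrite e.
Qed.

Lemma card_le_surj (T U : Type) (A : set T) (B : set U) (f : U -> T) :
  (forall x, A x -> exists2 y, B y & f y = x) -> A #<= B.
Proof. by move=> h; apply: (@card_le_rel _ _ _ _ (fun x y => f y = x)) => // x x' y _ _ ->. Qed.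

Definition seg (T : Type) (lt : T -> T -> Prop) (x : T) : set T := [set y | lt y x].

(** Greedy choice along [lt]: the part of [A] below x is too small for its values to exhaust [B], so
    a fresh value is left for x. *)
Lemma card_le_wf (T U : Type) (lt : T -> T -> Prop) (A : set T) (B : set U) :
  strict_wo lt -> (forall x, A x -> ~ (B #<= A `&` seg lt x)) -> A #<= B.
Proof.
move=> [wf tr tri] h.
case: (pselect (A !=set0)) => [[a Aa]|nA]; last first.
  have -> : A = set0 by apply/seteqP; split=> // x Ax; case: nA; exists x.
  exact: card_ge0.
have [u0 _] : B !=set0.
  apply: contrapT => nB; apply: h Aa _.
  have -> : B = set0 by apply/seteqP; split=> // x Bx; case: nB; exists x.
  exact: card_ge0.
have [|x f g t fg gd /gd[Bt ne]|x f IH|f fP] := @wf_dependent_choice T U lt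
  (fun x f t => A x -> B t /\ forall y, A y -> lt y x -> f y <> t) wf.
- by exists.
- by split=> // y Ay yx; rewrite -fg //; exact: ne.
- case: (pselect (A x)) => [Ax|nA]; last by exists u0.
  apply: contrapT => nt; apply: (h x Ax); apply: (@card_le_surj _ _ _ _ f) => t Bt.
  apply: contrapT => no; apply: nt; exists t => _; split=> // y Ay yx e.
  by apply: no; exists y.
- apply: (@card_le_rel _ _ _ _ (fun x y => f x = y)) => [x Ax|x y _ Ax Ay <- e].
    by exists (f x) => //; exact: (fP x Ax).1.
  have [xy|//|yx] := tri x y.
    by case: ((fP y Ay).2 _ Ax xy).
  by case: ((fP x Ax).2 _ Ay yx).
Qed.

Lemma card_le_total (T U : Type) (A : set T) (B : set U) : A #<= B \/ B #<= A.
Proof.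
have [lt wo] := exists_strict_wo T.
case: (pselect (B #<= A)) => [|nBA]; [by right|left].
apply: (card_le_wf wo) => x Ax le; apply: nBA.
by apply: card_le_trans le _; apply: subset_card_le => y [].
Qed.

Lemma strict_wo_lex (T U : Type) (lt : T -> T -> Prop) (lu : U -> U -> Prop) :
  strict_wo lt -> strict_wo lu ->
  strict_wo (fun p q : T * U => lt p.1 q.1 \/ p.1 = q.1 /\ lu p.2 q.2).
Proof.
move=> [wt tt trit] [wu tu triu]; split.
- move=> [x y]; move: x y; apply: (well_founded_ind wt) => x IHx.
  apply: (well_founded_ind wu) => y IHy; constructor=> -[a b] /= [|[-> ba]].
    by move=> ax; exact: IHx.
  exact: IHy.
- move=> [x x'] [y y'] [z z'] /= [xy|[-> xy]] [yz|[<- yz]]; [left|left|left|right] => //.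
    exact: tt xy yz.
  by split=> //; exact: tu xy yz.
- move=> [x x'] [y y'] /=; case: (trit x y) => [?|->|?]; first by constructor 1; left.
    by case: (triu x' y') => [?|->|?]; [constructor 1; right|constructor 2|constructor 3; right].
  by constructor 3; left.
Qed.

Lemma strict_wo_preim (T U : Type) (lt : T -> T -> Prop) (f : U -> T) :
  injective f -> strict_wo lt -> strict_wo (fun x y => lt (f x) (f y)).
Proof.
move=> finj [wf tr tri]; split.
- move=> x; have [y e] : exists y, y = f x by eexists.
  move: y x e; apply: (well_founded_ind wf) => y IH x e; constructor=> z zx.
  by apply: (IH (f z)) => //; rewrite e.
- by move=> x y z; exact: tr.
- move=> x y; case: (tri (f x) (f y)) => [?|/finj|?].
  + by constructor 1.
  + by constructor 2.
  + by constructor 3.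
Qed.

(** Hilbert's hotel along an injected copy of the natural numbers. *)
Lemma card_setU1_le (T : Type) (x : T) (A : set T) : infinite_set A -> x |` A #<= A.
Proof.
move=> infA; case: (pselect (A x)) => [Ax|nAx].
  by apply: subset_card_le => y [->|].
have /card_le_fun[|f [fA finj]] := (infiniteP A).1 infA; first by exists.
apply: (@card_le_rel _ _ _ _ (fun y z => (y = x /\ z = f 0) \/
  (y <> x /\ exists n, y = f n /\ z = f n.+1) \/
  (y <> x /\ (forall n, y <> f n) /\ z = y))).
  move=> y [->|Ay]; first by exists (f 0); [exact: fA|left].
  have ne : y <> x by move=> e; rewrite e in Ay.
  case: (pselect (exists n, y = f n)) => [[n yn]|no].
    by exists (f n.+1); [exact: fA|right; left; split=> //; exists n].
  by exists y => //; right; right; do 2?split=> //; move=> n e; apply: no; exists n.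
move=> y y' z _ _ [[-> ->]|[[_ [n [-> ->]]]|[_ [h ->]]]] [[-> e]|[[_ [m [-> e]]]|[_ [h' e]]]] //.
- by have := finj _ _ I I e.
- by case: (h' 0).
- by have := finj _ _ I I e.
- by have /succn_inj-> := finj _ _ I I e.
- by case: (h' n.+1).
- by case: (h 0).
- by case: (h m.+1).
Qed.

Lemma card_setX_le (T U T' U' : Type) (A : set T) (B : set U) (A' : set T') (B' : set U') :
  A #<= A' -> B #<= B' -> A `*` B #<= A' `*` B'.
Proof.
move=> /card_le_inj[r [rt ri _]] /card_le_inj[s [st si _]].
apply: (@card_le_rel _ _ _ _ (fun p q => r p.1 q.1 /\ s p.2 q.2)).
  by move=> [x y] [/= /rt[x' Ax' rx] /st[y' By' sy]]; exists (x', y').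
by move=> [x y] [x' y'] [z z'] /= _ _ [a b] [a' b']; congr pair; [exact: ri a a'|exact: si b b'].
Qed.

(** Pairs are ordered by their maximum and then lexicographically. A proper segment of this order
    lies in the square of a segment of [T] with its endpoint added, so it cannot cover a set [S]
    that embeds into none of its own segments. *)
Lemma card_squareT_le (T : Type) : infinite_set [set: T] -> [set: T] `*` [set: T] #<= [set: T].
Proof.
move=> infT; have [lt wo] := exists_strict_wo T; have [wf tr tri] := wo.
pose sq (S : set T) := S `*` S #<= S.
have core (S : set T) : infinite_set S -> (forall x y, lt x y -> S y -> S x) ->
    (forall y, S y -> ~ (S #<= seg lt y) /\ (infinite_set (seg lt y) -> sq (seg lt y))) -> sq S.
  move=> infS _ hS.
  pose mx (p : T * T) := if pselect (lt p.1 p.2) then p.2 else p.1.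
  have wo2 := strict_wo_preim (f := fun p : T * T => (mx p, p)) (fun p q e => f_equal snd e)
    (strict_wo_lex wo (strict_wo_lex wo wo)).
  apply: (card_le_wf wo2) => p [Sp1 Sp2].
  set m := mx p; have Sm : S m by rewrite /m /mx; case: pselect.
  pose C := m |` seg lt m.
  have leC (q : T * T) z : z = q.1 \/ z = q.2 -> (mx q = m \/ lt (mx q) m) -> C z.
    move=> hz hq; suff : z = mx q \/ lt z (mx q).
      case: hq => [->|h] [->|h']; [by left|by right|by right|right; exact: tr h' h].
    rewrite /mx; case: pselect => [h|h]; case: hz => ->; [by right|by left|by left|].
    by case: (tri q.1 q.2) => //; [left|right].
  have sub : S `*` S `&` seg (fun x y => lt (mx x) (mx y) \/
      mx x = mx y /\ (lt x.1 y.1 \/ x.1 = y.1 /\ lt x.2 y.2)) p `<=` C `*` C.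
    move=> q [_ h]; have {}h : mx q = m \/ lt (mx q) m by case: h => [|[->]]; [right|left].
    by split; apply: (leC q) => //; [left|right].
  move=> le; have {sub}le := card_le_trans le (subset_card_le sub).
  case: (pselect (finite_set C)) => [finC|infC].
    by apply: infS; apply: card_le_finite le _; exact: finite_setX.
  have infm : infinite_set (seg lt m).
    by move=> fm; apply: infC; rewrite finite_setU; split.
  have Cm : C #<= seg lt m by exact: card_setU1_le.
  have [nle /(_ infm) sm] := hS _ Sm.
  by apply: nle; apply: card_le_trans le _; apply: card_le_trans (card_setX_le Cm Cm) sm.
have trans (S S' : set T) : S #<= S' -> S' #<= S -> sq S' -> sq S.
  move=> SS' S'S h; apply: card_le_trans (card_setX_le SS' SS') _.
  exact: card_le_trans h S'S.
(* A segment either has the size of a smaller one, which the induction covers, or embeds into no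
   smaller one, and then [core] applies. *)
have claim : forall x, infinite_set (seg lt x) -> sq (seg lt x).
  apply: (well_founded_ind wf) => x IH infx.
  have segS y : lt y x -> seg lt y `<=` seg lt x by move=> yx z zy; exact: tr zy yx.
  case: (pselect (exists2 y, lt y x & seg lt x #<= seg lt y)) => [[y yx le]|no].
    apply: (trans _ (seg lt y)) => //; first exact/subset_card_le/segS.
    by apply: IH => // fy; apply: infx; exact: card_le_finite le fy.
  apply: core => // [y z yz zx|y yx]; first exact: tr yz zx.
  by split=> [le|]; [apply: no; exists y|exact: IH].
case: (pselect (exists y, [set: T] #<= seg lt y)) => [[y le]|no].
  apply: (trans _ (seg lt y)) => //; first exact: subset_card_le.
  by apply: claim => fy; apply: infT; exact: card_le_finite le fy.
by apply: core => // y _; split=> [le|]; [apply: no; exists y|exact: claim].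
Qed.

(** * Sets of size at most a fixed infinite cardinal *)

Section SmallSets.
Variables (W : Type) (infW : infinite_set [set: W]).

Lemma small_bigcup (I T : Type) (A : set I) (F : I -> set T) :
  A #<= [set: W] -> (forall i, A i -> F i #<= [set: W]) ->
  \bigcup_(i in A) F i #<= [set: W].
Proof.
move=> /card_le_inj[r [rt ri _]] hF; apply: card_le_trans (card_squareT_le infW).
have hf i : exists s : T -> W -> Prop, A i ->
    (forall x, F i x -> exists y, s x y) /\ (forall x x' y, s x y -> s x' y -> x = x').
  case: (pselect (A i)) => [/hF/card_le_inj[s [st si _]]|]; last by exists (fun _ _ => True).
  by exists s => _; split=> [x /st[y _ ?]|//]; exists y.
have [s sP] := choice hf.
apply: (@card_le_rel _ _ _ _ (fun x w => exists i, [/\ A i, r i w.1 & s i x w.2])).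
  move=> x [i Ai Fx]; have [w _ rw] := rt i Ai; have [w' sw] := (sP i Ai).1 x Fx.
  by exists (w, w') => //; exists i.
move=> x x' w _ _ [i [Ai ri1 s1]] [j [Aj rj s2]].
have e := ri _ _ _ ri1 rj; rewrite e in Ai s1 *.
exact: (sP j Aj).2 s1 s2.
Qed.

Lemma small_finite (T : Type) (A : set T) : finite_set A -> A #<= [set: W].
Proof.
move=> fA; have [//|le] := card_le_total A [set: W].
by case: infW; exact: card_le_finite le fA.
Qed.

Lemma small_setU (T : Type) (A B : set T) :
  A #<= [set: W] -> B #<= [set: W] -> A `|` B #<= [set: W].
Proof.
move=> sA sB; rewrite -bigcup2E; apply: small_bigcup; first exact/infiniteP.
by move=> [|[|n]] _ //=; rewrite /bigcup2 /=; exact: card_ge0.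
Qed.

Lemma small_subset (T : Type) (A B : set T) : A `<=` B -> B #<= [set: W] -> A #<= [set: W].
Proof. by move=> /subset_card_le; exact: card_le_trans. Qed.

Lemma small_nat : [set: nat] #<= [set: W].
Proof. exact/infiniteP. Qed.

Lemma small_image (T U : Type) (f : T -> U) (A : set T) :
  A #<= [set: W] -> f @` A #<= [set: W].
Proof. exact: card_le_trans (card_image_le _ _). Qed.

End SmallSets.

Lemma card_sig_le (T : Type) (A : set T) : [set: {x | A x}] #<= A.
Proof.
by apply: (@card_le_rel _ _ _ _ (fun u x => sval u = x)) => [[x Ax] _|[x ?] [y ?] z _ _ /= <- e];
  [exists x|exact: eq_exist].
Qed.

Lemma card_le_sig (T : Type) (A : set T) : A #<= [set: {x | A x}].
Proof.
by apply: (@card_le_rel _ _ _ _ (fun x u => sval u = x)) => [x Ax|x y u _ _ <- //];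
  exists (exist _ x Ax).
Qed.

Lemma card_lt_max (T U K : Type) : card_lt T K -> card_lt U K ->
  exists2 D, card_lt D K & [set: T] #<= [set: D] /\ [set: U] #<= [set: D].
Proof.
by move=> TK UK; have [TU|UT] := card_le_total [set: T] [set: U]; [exists U|exists T].
Qed.

(** The order type of [lt] is the initial ordinal of the successor cardinal of |W|. *)
Definition succ_wo (W L : Type) (lt : L -> L -> Prop) : Prop :=
  [/\ strict_wo lt, forall y, seg lt y #<= [set: W] & ~ ([set: L] #<= [set: W])].

Section SuccWo.
Variables (W L : Type) (lt : L -> L -> Prop).
Hypotheses (infW : infinite_set [set: W]) (succL : succ_wo W lt).

Lemma succ_wo_lt : card_lt W L.
Proof.
have [_ _ nLW] := succL; split=> //.
by have [|//] := card_le_total [set: W] [set: L].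
Qed.

(** If [Q] did not embed into [W], no segment of [L] could cover [Q], and greedy choice would embed
    [L] into [Q]. *)
Lemma succ_wo_le (Q : Type) : card_lt Q L -> [set: Q] #<= [set: W].
Proof.
have [wo segW _] := succL; move=> [_ nLQ]; apply: contrapT => nQW; apply: nLQ.
apply: (card_le_wf wo) => x _ le; apply: nQW; apply: card_le_trans le _.
by apply: small_subset (segW x) => y [].
Qed.

Lemma succ_wo_successor : successor_cardinal L.
Proof. by exists W; split; [exact: succ_wo_lt|exact: succ_wo_le]. Qed.

Lemma succ_wo_infinite : infinite_set [set: L].
Proof. by move=> fL; apply: infW; exact: card_le_finite succ_wo_lt.1 fL. Qed.

Lemma small_lt (Q : Type) (A : set Q) : A #<= [set: W] -> card_lt {x | A x} L.
Proof.
have [_ _ nLW] := succL; move=> AW; have {}AW := card_le_trans (card_sig_le A) AW.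
by split; [exact: card_le_trans succ_wo_lt.1|move=> le; apply: nLW; exact: card_le_trans AW].
Qed.

(** Regularity of a successor cardinal: without a bound, [L] would be a union of at most |W| closed
    segments of size at most |W|. *)
Lemma small_bounded (I : Type) (A : set I) (f : I -> L) :
  A #<= [set: W] -> exists b, forall i, A i -> lt (f i) b.
Proof.
have [[wf tr tri] segW nLW] := succL.
move=> AW; apply: contrapT => nb; apply: nLW.
have -> : [set: L] = \bigcup_(i in A) ([set f i] `|` seg lt (f i)).
  apply/seteqP; split=> // x _; apply: contrapT => nx; apply: nb; exists x => i Ai.
  by case: (tri (f i) x) => // h; case: nx; exists i => //; [left|right].
apply: small_bigcup => // i _; apply: small_setU => //; apply: small_finite => //.
Qed.

Lemma small_bounded_nat (f : nat -> L) : exists b, forall n, lt (f n) b.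
Proof.
have [b h] := @small_bounded nat [set: nat] f (small_nat infW).
by exists b => n; exact: h.
Qed.

End SuccWo.

(** * Singular cardinals: successors below them and continuous filtrations *)

Section Singular.
Variables (K : Type) (K_singular : singular K).

Lemma singular_data : exists (lt : K -> K -> Prop) (C : set K),
  [/\ strict_wo lt, forall x, card_lt {y | lt y x} K, card_lt {c | C c} K
    & forall x, exists2 c, C c & lt x c].
Proof.
have [infK [r [[/well_order_strict_wo wo seglt] [C [cof CK]]]]] := K_singular.
have [_ _ tri] := wo.
exists (fun x y => r x y /\ x <> y), C; split=> // x.
(* Cofinality is given for the reflexive order; it becomes strict by first moving up from x. A last
   element x is impossible, since K would then have the size of the segment below x, which absorbs
   one more point. *)
have [y [xy neq]] : exists y, r x y /\ x <> y.
  apply: contrapT => no; have [_] := seglt x; apply.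
  pose S' := [set y | r y x /\ y <> x].
  have sub : [set: K] `<=` x |` S'.
    by move=> y _; case: (tri y x) => h; [right|left|case: no; exists y].
  have infS : infinite_set S'.
    move=> fS; apply: infK; apply: sub_finite_set sub _.
    by rewrite finite_setU; split=> //; exact: finite_set1.
  apply: card_le_trans (card_le_sig S'); apply: card_le_trans (card_setU1_le x infS).
  exact: subset_card_le.
have [c Cc yc] := cof y; exists c => //.
have [_ tr _] := wo; case: (pselect (y = c)) => [<- //|nyc].
exact: tr (conj xy neq) (conj yc nyc).
Qed.

(** A singular cardinal is a limit cardinal: if all segments of [K] had size at most |W|, then [K]
    would be a union of fewer than |K| of them and hence too small. The segment below the least
    exception x has the order type of the successor of |W|. *)
Lemma singular_succ (W : Type) : infinite_set [set: W] -> card_lt W K ->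
  exists (L : Type) (lt : L -> L -> Prop), succ_wo W lt /\ card_lt L K.
Proof.
move=> infW WK; have [lt [C [wo segK CK cof]]] := singular_data.
have [wf tr tri] := wo.
have [x nx min] : exists2 x, ~ (seg lt x #<= [set: W]) &
    forall y, ~ (seg lt y #<= [set: W]) -> ~ lt y x.
  apply: strict_wo_min => //; apply: contrapT => no.
  have [D [_ nKD] [WD CD]] := card_lt_max WK CK; apply: nKD.
  have infD : infinite_set [set: D] by move=> fD; apply: infW; exact: card_le_finite WD fD.
  have -> : [set: K] = \bigcup_(c in C) seg lt c.
    by apply/seteqP; split=> // x _; have [c Cc xc] := cof x; exists c.
  apply: small_bigcup => // [|c _]; first exact: card_le_trans (card_le_sig C) CD.
  apply: card_le_trans WD; apply: contrapT => h; apply: no; by exists c.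
exists {y | lt y x}, (fun u v => lt (sval u) (sval v)); split; last exact: segK.
split.
- apply: (strict_wo_preim (f := sval)) => // -[u ?] [v ?] /= e; exact: eq_exist.
- move=> [y yx]; apply: (@card_le_trans _ _ _ (seg lt y)); last first.
    by apply: contrapT => h; exact: min h yx.
  apply: (@card_le_rel _ _ _ _ (fun u z => sval u = z)) => [[u ux] uy|[u ?] [v ?] z _ _ /= <- e].
    by exists u.
  exact: eq_exist.
- by move=> le; apply: nx; exact: card_le_trans (card_le_sig _) le.
Qed.

(* The [B a] play the role of a continuous cofinal sequence of cardinals below
   [K]; a limit index is one without a largest smaller index. *)
Lemma singular_filtration (N : Type) : infinite_set [set: N] -> card_lt N K ->
  exists (A : Type) (la : A -> A -> Prop) (B : A -> set K),
  [/\ strict_wo la, forall a b, la a b -> B a `<=` B b,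
      forall y, exists a, B a y,
      forall a, [/\ [set: A] #<= [set: {y | B a y}], [set: N] #<= [set: {y | B a y}]
        & card_lt {y | B a y} K]
    & forall a, (exists b, la b a) -> (forall b, la b a -> exists2 c, la b c & la c a) ->
        forall y, B a y -> exists2 b, la b a & B b y].
Proof.
move=> infN NK; have [lt [C [wo segK CK cof]]] := singular_data.
have [wf tr tri] := wo.
(* Closed segments ending at points of [C] strictly below c, instead of the segment below c itself:
   this is continuous at limit points of the order on [C], even if [C] is not closed in [K]. *)
pose B0 c := [set y | exists b, [/\ C b, lt b c & y = b \/ lt y b]].
have BS c d : lt c d -> B0 c `<=` B0 d.
  by move=> cd y [b [Cb bc yb]]; exists b; split=> //; exact: tr bc cd.
have Bseg c : B0 c `<=` seg lt c by move=> y [b [Cb bc [->|yb]]] //; exact: tr yb bc.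
have Bcov y : exists2 c, C c & B0 c y.
  have [b Cb yb] := cof y; have [c Cc bc] := cof b; exists c => //; exists b; split=> //.
  by right.
have [D [_ nKD] [ND CD]] := card_lt_max NK CK.
have infD : infinite_set [set: D] by move=> fD; apply: infN; exact: card_le_finite ND fD.
(* Discarding the indices below c0 makes every remaining [B0 c] at least as large as [N] and as the
   index set. If no c0 existed, [K] would be a union of |C| sets of size at most |D|. *)
have [c0 Cc0 DB] : exists2 c0, C c0 & [set: D] #<= B0 c0.
  apply: contrapT => no; apply: nKD.
  have -> : [set: K] = \bigcup_(c in C) B0 c.
    by apply/seteqP; split=> // y _; have [c Cc By] := Bcov y; exists c.
  apply: small_bigcup => // [|c Cc]; first exact: card_le_trans (card_le_sig C) CD.
  by case: (card_le_total (B0 c) [set: D]) => // le; case: no; exists c.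
pose A := {c | C c /\ ~ lt c c0}.
have Alt (a : A) : c0 = sval a \/ lt c0 (sval a).
  by case: a => c [/= Cc nc]; case: (tri c0 c) => h; [right|left|case: nc].
have BA (a : A) : B0 c0 `<=` B0 (sval a) by case: (Alt a) => [<-|/BS].
exists A, (fun a b => lt (sval a) (sval b)), (fun a => B0 (sval a)); split.
- apply: (strict_wo_preim (f := sval)) => // -[u ?] [v ?] /= e; exact: eq_exist.
- by move=> a b; exact: BS.
- move=> y; have [c Cc cy] := Bcov y; case: (pselect (lt c c0)) => h.
    exists (exist _ c0 (conj Cc0 (strict_wo_irr wo))); exact: BS h _ cy.
  by exists (exist _ c (conj Cc h)).
- move=> a; have DBa : [set: D] #<= [set: {y | B0 (sval a) y}].
    apply: card_le_trans DB _; apply: card_le_trans (card_le_sig _).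
    exact: subset_card_le (BA a).
  split; [apply: card_le_trans DBa|apply: card_le_trans ND DBa|].
    apply: card_le_trans CD; apply: card_le_trans (card_le_sig C).
    apply: card_le_trans (card_sig_le (fun c => C c /\ ~ lt c c0)) _.
    by apply: subset_card_le => c [].
  have [le nle] := segK (sval a).
  have le1 : [set: {y | B0 (sval a) y}] #<= [set: {y | lt y (sval a)}].
    apply: card_le_trans (card_sig_le _) _; apply: card_le_trans (card_le_sig _).
    exact: subset_card_le (Bseg _).
  by split; [exact: card_le_trans le1 le|move=> h; apply: nle; exact: card_le_trans h le1].
- move=> a [b0 b0a] lim y [b [Cb ba yb]].
  have [b1 [b1a b1b]] : exists b1 : A, lt (sval b1) (sval a) /\ (b = sval b1 \/ lt b (sval b1)).
    case: (pselect (lt b c0)) => h.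
      by exists b0; split=> //; right; case: (Alt b0) => [<- //|]; exact: tr.
    by exists (exist _ b (conj Cb h)); split=> //; left.
  have [c b1c ca] := lim _ b1a; exists c => //; exists b; split=> //.
  by case: b1b => [->|/tr]; last exact.
Qed.

End Singular.

Local Open Scope ring_scope.

(** * Homomorphisms, quotients and extensions *)

Section Rhom.
Variables (R : rngType).
Implicit Types A B C : rmodType R.

Lemma rmod_actr0 A (x : A) : x *> 0 = 0.
Proof. by apply: (addrI (x *> 0)); rewrite -rmod_actDr !addr0. Qed.

Lemma rmod_actNr A (x : A) a : x *> - a = - (x *> a).
Proof. by apply: (addIr (x *> a)); rewrite -rmod_actDr !addNr rmod_actr0. Qed.

Lemma rmod_act_sum A (I : Type) (s : seq I) (F : I -> A) a :
  (\sum_(i <- s) F i) *> a = \sum_(i <- s) F i *> a.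
Proof.
by elim: s => [|i s IH]; rewrite ?big_nil ?rmod_act0 // !big_cons rmod_actDl IH.
Qed.

Lemma rhomD A B (f : A -> B) x y : rhom f -> f (x + y) = f x + f y.
Proof. by case=> fD _; exact: fD. Qed.

Lemma rhomZ A B (f : A -> B) x a : rhom f -> f (x *> a) = f x *> a.
Proof. by case=> _ fZ; exact: fZ. Qed.

Lemma rhom0 A B (f : A -> B) : rhom f -> f 0 = 0.
Proof. by move=> hf; apply: (addrI (f 0)); rewrite -rhomD // !addr0. Qed.

Lemma rhomN A B (f : A -> B) x : rhom f -> f (- x) = - f x.
Proof. by move=> hf; apply: (addrI (f x)); rewrite -rhomD // !subrr rhom0. Qed.

Lemma rhomB A B (f : A -> B) x y : rhom f -> f (x - y) = f x - f y.
Proof. by move=> hf; rewrite rhomD // rhomN. Qed.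

Lemma rhom_sum A B (f : A -> B) (I : Type) (s : seq I) (F : I -> A) :
  rhom f -> f (\sum_(i <- s) F i) = \sum_(i <- s) f (F i).
Proof.
move=> hf; elim: s => [|i s IH]; first by rewrite !big_nil rhom0.
by rewrite !big_cons rhomD // IH.
Qed.

Lemma rhom_id A : rhom (@id A).
Proof. by split. Qed.

Lemma rhom_comp A B C (f : A -> B) (g : B -> C) : rhom f -> rhom g -> rhom (g \o f).
Proof.
move=> hf hg; split=> [x y|a x] /=; first by rewrite (rhomD _ _ hf) rhomD.
by rewrite (rhomZ _ _ hf) rhomZ.
Qed.

Lemma rhom_zero A B : rhom (fun _ : A => 0 : B).
Proof. by split=> [x y|a x]; rewrite ?addr0 ?rmod_act0. Qed.

Lemma submod_val_hom A (S : submodule A) : rhom (@submod_val R A S).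
Proof. by split. Qed.

Lemma submod_inE A (S : submodule A) (x : submod S) : submodule_set S (submod_val x).
Proof. exact/asboolP/(submod_valP x). Qed.

Definition submod_in A (S : submodule A) x (Sx : submodule_set S x) : submod S :=
  SubmodOf (introT (asboolP _) Sx : x \in submod_pred S).

Lemma submod_val_inj A (S : submodule A) : injective (@submod_val R A S).
Proof. exact: val_inj. Qed.

Section Image.
Variables (A B : rmodType R) (f : A -> B) (hf : rhom f).

Fact image_submodule0 : [set y | exists x, f x = y] 0.
Proof. by exists 0; exact: rhom0. Qed.

Fact image_submoduleB y z :
  (exists x, f x = y) -> (exists x, f x = z) -> exists x, f x = y - z.
Proof. by move=> [x <-] [t <-]; exists (x - t); exact: rhomB. Qed.

Fact image_submodule_act y a : (exists x, f x = y) -> exists x, f x = y *> a.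
Proof. by move=> [x <-]; exists (x *> a); exact: rhomZ. Qed.

Definition image_submodule : submodule B :=
  Submodule image_submodule0 image_submoduleB image_submodule_act.

End Image.

Section UnitaryPart.
Variables (A : rmodType R).
Implicit Types x y : A.

Lemma unitary_part0 : unitary_part A 0.
Proof. by exists [::]; rewrite big_nil. Qed.

Lemma unitary_partD x y : unitary_part A x -> unitary_part A y -> unitary_part A (x + y).
Proof. by move=> [s ->] [t ->]; exists (s ++ t); rewrite big_cat. Qed.

Lemma unitary_partN x : unitary_part A x -> unitary_part A (- x).
Proof.
move=> [s ->]; exists [seq (- p.1, p.2) | p <- s]; rewrite big_map /= -sumrN.
by apply: eq_bigr => p _; rewrite rmod_actN.
Qed.

Lemma unitary_part_act x a : unitary_part A (x *> a).
Proof. by exists [:: (x, a)]; rewrite big_seq1. Qed.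

Lemma unitary_partB x y : unitary_part A x -> unitary_part A y -> unitary_part A (x - y).
Proof. by move=> ux uy; apply: unitary_partD => //; exact: unitary_partN. Qed.

Definition unitary_submodule : submodule A :=
  Submodule unitary_part0 unitary_partB (fun x a _ => unitary_part_act x a).

End UnitaryPart.

Lemma unitary_part_hom A B (f : A -> B) x :
  rhom f -> unitary_part A x -> unitary_part B (f x).
Proof.
move=> hf [s ->]; exists [seq (f p.1, p.2) | p <- s].
by rewrite big_map rhom_sum //; apply: eq_bigr => p _; rewrite rhomZ.
Qed.

Lemma unitary_surj A B (f : A -> B) :
  rhom f -> (forall y, exists x, f x = y) -> unitary A -> unitary B.
Proof. by move=> hf sf uA y; have [x <-] := sf y; exact: unitary_part_hom. Qed.

Lemma unitary_extension (D E N : rmodType R) (i : D -> E) (p : E -> N) :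
  rhom i -> rhom p -> (forall y, exists x, p x = y) ->
  (forall x, p x = 0 -> exists d, i d = x) ->
  unitary D -> unitary N -> unitary E.
Proof.
move=> hi hp sp ex uD uN x; have [s es] := uN (p x).
have [g gP] := choice sp.
pose y := \sum_(q <- s) g q.1 *> q.2.
have py : p y = p x.
  by rewrite /y rhom_sum // es; apply: eq_bigr => q _; rewrite rhomZ // gP.
have [|d dE] := ex (x - y); first by rewrite rhomB // py subrr.
rewrite -[x](subrK y) -dE; apply: unitary_partD; first exact: unitary_part_hom.
by exists [seq (g q.1, q.2) | q <- s]; rewrite big_map.
Qed.

(* R = R^2, since every element of R is a finite sum of elements r e = (r e) e. *)
Definition act_in A (y : A) (r : R) : submod (unitary_submodule A) :=
  @submod_in A (unitary_submodule A) _ (unitary_part_act y r).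

Lemma unitary_part_unitary A : enough_idempotents R -> unitary (submod (unitary_submodule A)).
Proof.
move=> [E [idE _ _ [gen _]]] [x xP]; have [s es] := elimT (asboolP _) xP.
have h (y : A) r : unitary_part (submod (unitary_submodule A)) (act_in y r).
  have [t [u [_ tP rE]]] := gen r.
  have {rE} -> : act_in y r =
      \sum_(e <- t) act_in y (u e).
    apply: submod_val_inj; rewrite (rhom_sum _ _ (submod_val_hom _)) /= rE.
    by elim: t {tP rE} => [|e t IH]; rewrite ?big_nil ?rmod_actr0 // !big_cons rmod_actDr IH.
  elim: t tP => [|e t IH] tP; first by rewrite big_nil; exact: unitary_part0.
  rewrite big_cons; apply: unitary_partD; last first.
    by apply: IH => f ft; apply: tP; rewrite inE ft orbT.
  have [Ee [q ue]] := tP e (mem_head _ _).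
  have -> : act_in y (u e) = act_in y (u e) *> e.
    by apply: submod_val_inj => /=; rewrite rmod_actA ue -rng_mulA idE.
  exact: unitary_part_act.
have -> : SubmodOf xP = \sum_(p <- s) act_in p.1 p.2.
  by apply: submod_val_inj; rewrite (rhom_sum _ _ (submod_val_hom _)) /=.
elim: s {es} => [|p s IH]; first by rewrite big_nil; exact: unitary_part0.
by rewrite big_cons; apply: unitary_partD.
Qed.

End Rhom.

Section Quotient.
Variables (R : rngType) (A : rmodType R) (S : submodule A).

Definition quotmod_of : Type := Quotient.quot (submod_pred S).
HB.instance Definition _ := GRing.Zmodule.on quotmod_of.

Definition quot_pi (x : A) : quotmod_of := \pi_(Quotient.quot (submod_pred S))%qT x.

Lemma quot_pi_eq x y : quot_pi x = quot_pi y <-> submodule_set S (x - y).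
Proof.
rewrite /quot_pi; split=> [/eqP|h]; last apply/eqP.
  by rewrite -Quotient.idealrBE => /asboolP.
by rewrite -Quotient.idealrBE; apply/asboolP.
Qed.

Lemma quot_pi_surj y : exists x, quot_pi x = y.
Proof. by exists (repr (y : Quotient.quot (submod_pred S))); rewrite /quot_pi reprK. Qed.

Lemma quot_piD x y : quot_pi (x + y) = quot_pi x + quot_pi y.
Proof. by rewrite /quot_pi raddfD. Qed.

Definition quot_repr (y : quotmod_of) : A := sval (cid (quot_pi_surj y)).

Lemma quot_reprK y : quot_pi (quot_repr y) = y.
Proof. exact: svalP (cid (quot_pi_surj y)). Qed.

Definition quot_act (y : quotmod_of) (a : R) : quotmod_of := quot_pi (quot_repr y *> a).

Lemma quot_actE x a : quot_act (quot_pi x) a = quot_pi (x *> a).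
Proof.
apply/quot_pi_eq; rewrite -rmod_actB; apply: submodule_act.
by apply/quot_pi_eq; rewrite quot_reprK.
Qed.

Fact quot_actA x a b : quot_act (quot_act x a) b = quot_act x (a ** b).
Proof. by rewrite -[x]quot_reprK !quot_actE rmod_actA. Qed.

Fact quot_actDl x y a : quot_act (x + y) a = quot_act x a + quot_act y a.
Proof.
by rewrite -[x]quot_reprK -[y]quot_reprK -quot_piD !quot_actE rmod_actDl quot_piD.
Qed.

Fact quot_actDr x a b : quot_act x (a + b) = quot_act x a + quot_act x b.
Proof. by rewrite -[x]quot_reprK !quot_actE rmod_actDr quot_piD. Qed.

HB.instance Definition _ := Zmodule_isRmodule.Build R quotmod_of
  quot_actA quot_actDl quot_actDr.

Definition quotmod : rmodType R := quotmod_of.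

Lemma quot_pi_hom : rhom (quot_pi : A -> quotmod).
Proof. by split=> [x y|a x]; [exact: quot_piD|exact: esym (quot_actE x a)]. Qed.

Lemma quot_pi0 x : (quot_pi x : quotmod) = 0 <-> submodule_set S x.
Proof. by rewrite -(rhom0 quot_pi_hom) quot_pi_eq subr0. Qed.

End Quotient.

Section BinaryProduct.
Variables (R : rngType) (A B : rmodType R).

Definition pair_act (x : A * B) (a : R) : A * B := (x.1 *> a, x.2 *> a).

Fact pair_actA x a b : pair_act (pair_act x a) b = pair_act x (a ** b).
Proof. by rewrite /pair_act /= !rmod_actA. Qed.

Fact pair_actDl x y a : pair_act (x + y) a = pair_act x a + pair_act y a.
Proof. by rewrite /pair_act /= !rmod_actDl. Qed.

Fact pair_actDr x a b : pair_act x (a + b) = pair_act x a + pair_act x b.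
Proof. by rewrite /pair_act /= !rmod_actDr. Qed.

HB.instance Definition _ := Zmodule_isRmodule.Build R (A * B)%type
  pair_actA pair_actDl pair_actDr.

Lemma fst_hom : rhom (fst : A * B -> A).
Proof. by split. Qed.

Lemma pair_unitary : unitary A -> unitary B -> unitary (A * B : rmodType R)%type.
Proof.
move=> uA uB.
apply: (@unitary_extension _ B (A * B)%type A (fun b => (0, b)) fst) => //.
- by split=> [x y|a x]; congr pair; rewrite /= ?addr0 ?rmod_act0.
- by move=> y; exists (y, 0).
- by move=> [a b] /= ->; exists b.
Qed.

End BinaryProduct.

Definition ext1_splits (R : rngType) (N D : rmodType R) : Prop :=
  forall E : extension N D, exists2 s : N -> ext_mod E, rhom s & forall y, ext_proj E (s y) = y.

(** A given extension is compared with the trivial one on [N * D]. Conversely, a section of E yields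
    a retraction r onto D, and the equivalence transports the two components of x to E'. *)
Lemma Ext1_eq0_splits (R : rngType) (N D : rmodType R) :
  unitary N -> unitary D -> (Ext1_eq0 N D <-> ext1_splits N D).
Proof.
move=> uN uD; split=> [h E|h E E'].
  pose i (d : D) : (N * D)%type := (0, d).
  have hi : rhom i by split=> [x y|a x]; congr pair; rewrite /= ?addr0 ?rmod_act0.
  have inj_i : injective i by move=> x y [].
  have sfst (y : N) : exists x : (N * D)%type, x.1 = y by exists (y, 0).
  have ex (x : (N * D)%type) : x.1 = 0 <-> exists d, i d = x.
    by case: x => a b /=; split=> [->|[d [<-]]] //; exists b.
  pose E0 := Extension (pair_unitary uN uD) hi (@fst_hom _ N D) inj_i sfst ex.
  have [phi [hphi _ phiP]] := h E0 E.
  have hj : rhom (fun y : N => (y, 0) : (N * D)%type).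
    by split=> [x y|a x]; congr pair; rewrite /= ?addr0 ?rmod_act0.
  exists (fun y => phi (y, 0)); first exact: (rhom_comp hj hphi).
  by move=> y; rewrite phiP.
have [s hs sP] := h E; have [s' hs' sP'] := h E'.
have hp := ext_proj_hom E; have hi := ext_inj_hom E; have hi' := ext_inj_hom E'.
have rP x : exists d, ext_inj E d = x - s (ext_proj E x).
  by apply/ext_exact; rewrite rhomB // sP subrr.
have [r {}rP] := choice rP.
have hr : rhom r.
  split=> [x y|a x]; apply: (@ext_injective _ _ _ E); rewrite ?(rhomD _ _ hi) ?(rhomZ _ _ hi) !rP.
    by rewrite (rhomD _ _ hp) (rhomD _ _ hs) opprD addrACA.
  by rewrite (rhomZ _ _ hp) (rhomZ _ _ hs) rmod_actB.
exists (fun x => s' (ext_proj E x) + ext_inj E' (r x)); split.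
- split=> [x y|a x].
    by rewrite (rhomD _ _ hp) (rhomD _ _ hr) (rhomD _ _ hs') (rhomD _ _ hi') addrACA.
  by rewrite (rhomZ _ _ hp) (rhomZ _ _ hr) (rhomZ _ _ hs') (rhomZ _ _ hi') rmod_actDl.
- move=> d; have pd : ext_proj E (ext_inj E d) = 0 by apply/ext_exact; exists d.
  have -> : r (ext_inj E d) = d.
    by apply: (@ext_injective _ _ _ E); rewrite rP pd rhom0 // subr0.
  by rewrite pd rhom0 // add0r.
- move=> x; rewrite (rhomD _ _ (ext_proj_hom E')).
  rewrite sP'; have -> : ext_proj E' (ext_inj E' (r x)) = 0 by apply/ext_exact; exists (r x).
  exact: addr0.
Qed.

(** * Generators and relations *)

Section Words.
Variables (R : rngType) (X : Type).
Implicit Types (A B : rmodType R) (w : seq (X * R)).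

(** Words are unreduced formal combinations of generators; they are compared only through their
    values in modules, and [letter] means syntactic occurrence. *)
Definition eval A (x : X -> A) w : A := \sum_(p <- w) x p.1 *> p.2.

Fixpoint letter w (k : X) : Prop :=
  if w is p :: w' then p.1 = k \/ letter w' k else False.

Lemma letter_finite w : finite_set (letter w).
Proof.
elim: w => [|p w IH]; first by rewrite (_ : letter [::] = set0) //; exact: finite_set0.
rewrite (_ : letter (p :: w) = [set p.1] `|` letter w); first by rewrite finite_setU.
by apply/seteqP; split=> k [->|]; by [left|right].
Qed.

Lemma eval_cons A (x : X -> A) p w : eval x (p :: w) = x p.1 *> p.2 + eval x w.
Proof. by rewrite /eval big_cons. Qed.

Lemma eval_nil A (x : X -> A) : eval x [::] = 0.
Proof. by rewrite /eval big_nil. Qed.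

Lemma eval_cat A (x : X -> A) w w' : eval x (w ++ w') = eval x w + eval x w'.
Proof. by rewrite /eval big_cat. Qed.

Lemma eval_ext A (x y : X -> A) w : (forall k, letter w k -> x k = y k) -> eval x w = eval y w.
Proof.
elim: w => [|p w IH] h; first by rewrite !eval_nil.
by rewrite !eval_cons h ?IH //=; [move=> k wk; apply: h; right|left].
Qed.

Lemma rhom_eval A B (h : A -> B) (x : X -> A) w : rhom h -> h (eval x w) = eval (h \o x) w.
Proof. by move=> hh; rewrite /eval rhom_sum //; apply: eq_bigr => p _; rewrite rhomZ. Qed.

Definition wact w a : seq (X * R) := [seq (p.1, p.2 ** a) | p <- w].

Lemma eval_act A (x : X -> A) w a : eval x (wact w a) = eval x w *> a.
Proof.
by rewrite /eval big_map rmod_act_sum; apply: eq_bigr => p _; rewrite rmod_actA.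
Qed.

Definition wopp w : seq (X * R) := [seq (p.1, - p.2) | p <- w].

Lemma eval_opp A (x : X -> A) w : eval x (wopp w) = - eval x w.
Proof.
by rewrite /eval big_map -sumrN; apply: eq_bigr => p _; rewrite rmod_actNr.
Qed.

Lemma eval_sub A (x y : X -> A) w : eval (fun k => x k - y k) w = eval x w - eval y w.
Proof. by rewrite /eval -sumrB; apply: eq_bigr => p _; rewrite rmod_actB. Qed.

Lemma eval_add A (x y : X -> A) w : eval (fun k => x k + y k) w = eval x w + eval y w.
Proof. by rewrite /eval -big_split; apply: eq_bigr => p _; rewrite rmod_actDl. Qed.

Lemma eval0 A w : eval (fun=> 0 : A) w = 0.
Proof. by rewrite /eval big1 // => p _; rewrite rmod_act0. Qed.

End Words.

Definition wsubst (R : rngType) (I X : Type) (v : I -> seq (X * R)) (w : seq (I * R)) :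
  seq (X * R) := flatten [seq wact (v p.1) p.2 | p <- w].

Lemma eval_subst (R : rngType) (I X : Type) (A : rmodType R) (x : X -> A)
    (v : I -> seq (X * R)) w : eval x (wsubst v w) = eval (fun i => eval x (v i)) w.
Proof.
elim: w => [|p w IH]; first by rewrite !eval_nil.
by rewrite /wsubst /= eval_cat eval_act eval_cons; congr (_ + _).
Qed.

(* A set [P] of generators and relations stands for the module presented by
   them, relations whose letters are not all in [P] being ignored; [model P x]
   says that [x] defines a homomorphism from that module to [A]. *)
Section Models.
Variables (R : rngType) (X Y : Type) (e : X -> R) (rel : Y -> seq (X * R)).
Implicit Types (A B : rmodType R) (P Q : set (X + Y)).

Definition model P A (x : X -> A) : Prop :=
  (forall k, P (inl k) -> x k *> e k = x k) /\
  (forall j, P (inr j) -> (forall k, letter (rel j) k -> P (inl k)) -> eval x (rel j) = 0).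

Definition agree P A (x y : X -> A) : Prop := forall k, P (inl k) -> x k = y k.

Lemma model_sub P Q A (x : X -> A) : P `<=` Q -> model Q x -> model P x.
Proof.
move=> PQ [xe xr]; split=> [k /PQ|j /PQ Qj h]; first exact: xe.
by apply: xr => // k /h /PQ.
Qed.

Lemma model_agree P A (x y : X -> A) : agree P x y -> model P x -> model P y.
Proof.
move=> xy [xe xr]; split=> [k Pk|j Pj h]; first by rewrite -xy // xe.
by rewrite -(xr j Pj h); apply: eval_ext => k /h Pk; rewrite xy.
Qed.

Lemma model_hom P A B (h : A -> B) (x : X -> A) : rhom h -> model P x -> model P (h \o x).
Proof.
move=> hh [xe xr]; split=> [k Pk|j Pj hj] /=; first by rewrite -rhomZ // xe.
by rewrite -rhom_eval // xr // rhom0.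
Qed.

Lemma model_add P A (x y : X -> A) : model P x -> model P y -> model P (fun k => x k + y k).
Proof.
move=> [xe xr] [ye yr]; split=> [k Pk|j Pj hj]; first by rewrite rmod_actDl xe ?ye.
by rewrite eval_add xr ?yr ?addr0.
Qed.

Lemma model_sub_fun P A (x y : X -> A) : model P x -> model P y -> model P (fun k => x k - y k).
Proof.
move=> [xe xr] [ye yr]; split=> [k Pk|j Pj hj]; first by rewrite rmod_actB xe ?ye.
by rewrite eval_sub xr ?yr ?subr0.
Qed.

Lemma model0 P A : model P (fun _ : X => 0 : A).
Proof. by split=> [k _|j _ _]; [rewrite rmod_act0|rewrite eval0]. Qed.

Lemma agree_sub P Q A (x y : X -> A) : P `<=` Q -> agree Q x y -> agree P x y.
Proof. by move=> PQ h k /PQ; exact: h. Qed.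

Lemma agree_trans P A (x y z : X -> A) : agree P x y -> agree P y z -> agree P x z.
Proof. by move=> h h' k Pk; rewrite h // h'. Qed.

(* A relation has finitely many letters, so lies in a single member of a
   directed union. *)
Lemma model_bigcup (I : Type) (J : set I) (F : I -> set (X + Y)) A (x : X -> A) :
  (forall i j, J i -> J j -> exists2 l, J l & F i `|` F j `<=` F l) ->
  (forall i, J i -> model (F i) x) -> model (\bigcup_(i in J) F i) x.
Proof.
move=> dir h; split=> [k [i Ji Fi]|j [i Ji Fi] hj]; first exact: (h i Ji).1.
have [l Jl [Fl hl]] : exists2 l, J l & F l (inr j) /\ forall k, letter (rel j) k -> F l (inl k).
  elim: (rel j) hj => [|p w IH] hj; first by exists i.
  have [l Jl [Fl hl]] := IH (fun k wk => hj k (or_intror wk)).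
  have [l' Jl' Fl'] := hj _ (or_introl erefl).
  have [m Jm sub] := dir _ _ Jl Jl'; exists m => //; split; first by apply: sub; left.
  by move=> k /= [<-|/hl ?]; apply: sub; [right|left].
exact: (h l Jl).2.
Qed.

(** The last clause is compactness: a relation of [A] already holds in every model of some finite F,
    hence in M(P) for every P containing F. *)
Definition presents A (m : X -> A) : Prop :=
  [/\ model setT m, forall y, exists w, eval m w = y
    & forall w, eval m w = 0 -> exists2 F : set (X + Y), finite_set F &
        forall B (x : X -> B), model F x -> eval x w = 0].

Lemma presents_hom A (m : X -> A) B (x : X -> B) : presents m -> model setT x ->
  exists2 h : A -> B, rhom h & forall k, h (m k) = x k.
Proof.
move=> [mm gen rels] mx; have [v vP] := choice gen.
have ker w : eval m w = 0 -> eval x w = 0.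
  by move=> /rels[F _]; apply; exact: model_sub mx.
have eqw w w' : eval m w = eval m w' -> eval x w = eval x w'.
  move=> ww'; apply/eqP; rewrite -subr_eq0 -eval_opp -eval_cat; apply/eqP/ker.
  by rewrite eval_cat eval_opp ww' subrr.
exists (fun y => eval x (v y)).
  split=> [y z|a y]; first by rewrite -eval_cat; apply: eqw; rewrite eval_cat !vP.
  by rewrite -eval_act; apply: eqw; rewrite eval_act !vP.
move=> k; have -> : x k = eval x [:: (k, e k)].
  by rewrite eval_cons eval_nil addr0 mx.1.
by apply: eqw; rewrite vP eval_cons eval_nil addr0 mm.1.
Qed.

Lemma presents_hom_eq A (m : X -> A) B (g h : A -> B) : presents m -> rhom g -> rhom h ->
  (forall k, g (m k) = h (m k)) -> g = h.
Proof.
move=> [_ gen _] hg hh gh; apply: funext => y; have [w <-] := gen y.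
by rewrite !rhom_eval //; apply: eval_ext => k _; exact: gh.
Qed.

End Models.

(** * Elements of direct sums as words *)

Section SumSupport.
Variables (I : eqType) (V : zmodType) (F : I -> V).

Lemma sum_support (s t : seq I) : uniq s -> uniq t ->
  (forall i, F i <> 0 -> i \in s) -> (forall i, F i <> 0 -> i \in t) ->
  \sum_(i <- s) F i = \sum_(i <- t) F i.
Proof.
move=> us ut hs ht.
have red (r : seq I) : \sum_(i <- r) F i = \sum_(i <- r | F i != 0) F i.
  rewrite [LHS](bigID (fun i => F i == 0)) /= big1 ?add0r // => i /eqP //.
rewrite red [RHS]red -!(big_filter _ (fun i => F i != 0)).
apply: perm_big; apply: uniq_perm; rewrite ?filter_uniq // => i.
rewrite !mem_filter; case: eqP => //= Fi; by rewrite hs ?ht.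
Qed.

End SumSupport.

Section DirectSum.
Variables (R : rngType) (I : Type) (e : I -> R).
Local Notation V := (dsum (fun i => principal (e i))).
Implicit Types d : V.

Definition coef d (i : I) : R := submod_val (submod_val d i : principal (e i)).

Lemma coef_inj d d' : (forall i, coef d i = coef d' i) -> d = d'.
Proof.
move=> h; apply: submod_val_inj; apply: functional_extensionality_dep => i.
by apply: submod_val_inj; exact: h.
Qed.

Lemma coefD d d' i : coef (d + d') i = coef d i + coef d' i.
Proof. by []. Qed.

Lemma coefZ d a i : coef (d *> a) i = coef d i ** a.
Proof. by []. Qed.

Lemma coef_idem d i : idempotent_elt (e i) -> e i ** coef d i = coef d i.
Proof.
move=> ide; have [r] := submod_inE (submod_val d i : principal (e i)).
by rewrite /coef => ->; rewrite rng_mulA ide.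
Qed.

Lemma coef_finite d : finite_set [set i | coef d i <> 0].
Proof.
apply: sub_finite_set (submod_inE d) => i /= h di; apply: h.
by rewrite /coef di.
Qed.

Definition principal_elt (u r : R) : principal u :=
  @submod_in _ _ (Submodule (@principal0 R u) (@principalB R u) (@principal_act R u)) _
    (ex_intro _ r erefl : principal_set u (u ** r)).

Fact single_subproof i (r : R) :
  @dsum_set R I (fun i => principal (e i))
    (fun k => if pselect (k = i) then principal_elt (e k) r else 0).
Proof.
apply: (@sub_finite_set _ _ [set i]) (finite_set1 i) => k /=.
by case: pselect.
Qed.

Definition single i (r : R) : V := @submod_in _ _ (Submodule (@dsum0 R I (fun i => principal (e i)))
  (@dsumB R I (fun i => principal (e i))) (@dsum_act R I (fun i => principal (e i)))) _
  (single_subproof i r).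

Lemma coef_single i r k : coef (single i r) k = if pselect (k = i) then e k ** r else 0.
Proof. by rewrite /coef /=; case: pselect. Qed.

Definition supp d : seq {classic I} :=
  sval (cid ((@finite_seqP {classic I} [set i | coef d i <> 0]).1 (coef_finite d))).

Lemma suppE d (i : {classic I}) : coef d i <> 0 <-> i \in supp d.
Proof.
rewrite /supp; case: cid => s /= es; split=> [h|h].
  by have : [set i : {classic I} | coef d i <> 0] i by []; rewrite es.
by have : [set` s] i by []; rewrite -es.
Qed.

Definition dword d : seq (I * R) := [seq (i : I, coef d i) | i <- undup (supp d)].

Section Eval.
Variables (A : rmodType R) (x : I -> A).

Lemma eval_dword d (s : seq {classic I}) : uniq s ->
  (forall i : {classic I}, coef d i <> 0 -> i \in s) ->
  eval x (dword d) = \sum_(i <- s) x i *> coef d i.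
Proof.
move=> us hs; rewrite /eval big_map /=.
have nz i : x i *> coef d i <> 0 -> coef d i <> 0.
  by move=> h di; apply: h; rewrite di rmod_actr0.
apply: (@sum_support {classic I} A (fun i => x i *> coef d i)) => //; first exact: undup_uniq.
  by move=> i /nz /suppE; rewrite mem_undup.
by move=> i /nz /hs.
Qed.

Lemma eval_dword_hom : rhom (fun d => eval x (dword d)).
Proof.
split=> [d d'|a d] /=.
  pose s := undup (supp d ++ supp d').
  have us : uniq s by exact: undup_uniq.
  have s1 (i : {classic I}) : coef d i <> 0 -> i \in s.
    by move/suppE=> di; rewrite mem_undup mem_cat di.
  have s2 (i : {classic I}) : coef d' i <> 0 -> i \in s.
    by move/suppE=> di; rewrite mem_undup mem_cat di orbT.
  have s3 (i : {classic I}) : coef (d + d') i <> 0 -> i \in s.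
    move=> dd; case: (pselect (coef d i = 0)) => [d0|/s1 //]; apply: s2 => d0'.
    by apply: dd; rewrite coefD d0 d0' addr0.
  rewrite (eval_dword us s1) (eval_dword us s2) (eval_dword us s3) -big_split.
  by apply: eq_bigr => i _; rewrite coefD rmod_actDr.
rewrite -eval_act (@eval_dword _ (undup (supp d))) ?undup_uniq //.
  by rewrite /eval !big_map; apply: eq_bigr => i _; rewrite coefZ.
move=> i; rewrite coefZ mem_undup => h; apply/suppE => d0; apply: h; rewrite d0.
by apply: (addrI (0 ** a)); rewrite -rng_mulDl !addr0.
Qed.

Lemma eval_single i r : idempotent_elt (e i) -> eval x (dword (single i r)) = x i *> (e i ** r).
Proof.
move=> ide; rewrite (@eval_dword _ [:: i : {classic I}]) //.
  by rewrite big_seq1 coef_single; case: pselect.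
by move=> k; rewrite coef_single; case: pselect => //= ki _; rewrite inE; exact/eqP.
Qed.

End Eval.

Lemma single_sum d : (forall i, idempotent_elt (e i)) ->
  d = \sum_(i <- undup (supp d)) single i (coef d i).
Proof.
move=> ide; apply: coef_inj => k.
have -> : coef (\sum_(i <- undup (supp d)) single i (coef d i)) k =
    \sum_(i <- undup (supp d)) coef (single i (coef d i)) k.
  by elim: (undup _) => [|i s IH]; rewrite ?big_nil // !big_cons coefD IH.
case: (pselect (coef d k = 0)) => [dk|/suppE dk].
  rewrite dk big1 // => i _; rewrite coef_single; case: pselect => //= <-.
  by rewrite dk; apply: (addrI (e k ** 0)); rewrite -rng_mulDr !addr0.
rewrite (bigD1_seq (k : {classic I})) ?mem_undup ?undup_uniq //= big1 ?addr0.
  by rewrite coef_single; case: pselect => //= _; rewrite coef_idem.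
by move=> i /eqP ik; rewrite coef_single; case: pselect => // ki; case: ik.
Qed.

End DirectSum.

Lemma presented_presents (small : Type -> Prop) (R : rngType) (M : rmodType R) :
  presented small M -> exists (X Y : Type) (e : X -> R) (rel : Y -> seq (X * R)) (m : X -> M),
    [/\ small X, small Y, forall k, idempotent_elt (e k) & presents e rel m].
Proof.
move=> [I [J [e [f [[sI sJ ide idf] [h [p [hh hp sp ex]]]]]]]].
pose rel j := dword (h (single f j (f j))).
pose m i := p (single e i (e i)).
exists I, J, e, rel, m; split=> //.
have sgZ (T : Type) (u : T -> R) i r a : single u i (r ** a) = single u i r *> a.
  apply: coef_inj => k; rewrite coefZ !coef_single; case: pselect => /= [->|nki].
    by rewrite rng_mulA.
  by apply: (addrI (0 ** a)); rewrite -rng_mulDl !addr0.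
have sg (T : Type) (u : T -> R) i r : idempotent_elt (u i) ->
    single u i r = single u i (u i) *> r.
  move=> idu; rewrite -sgZ; apply: coef_inj => k; rewrite !coef_single.
  by case: pselect => //= ->; rewrite rng_mulA idu.
have pE d : p d = eval m (dword d).
  rewrite {1}(single_sum d ide) rhom_sum // /eval big_map; apply: eq_bigr => i _.
  by rewrite sg // rhomZ.
have evd (A : rmodType R) (x : I -> A) := eval_dword_hom e x.
split.
- split=> [i _|j _ _]; first by rewrite /m -rhomZ // -sg //.
  by rewrite -pE; apply/ex; eexists.
- by move=> y; have [d <-] := sp y; exists (dword d); rewrite pE.
move=> w w0.
pose d := \sum_(q <- w) single e q.1 q.2.
have pd : p d = 0.
  by rewrite rhom_sum // -[RHS]w0 /eval; apply: eq_bigr => q _; rewrite sg // rhomZ.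
have [z zd] := (ex d).1 pd.
(* F needs the letters of each relation j, since [model] ignores a relation with a missing letter.
   It needs the letters of w because the summands of d have coefficients [e k ** r] where w has r,
   and the two agree on x only if [x k *> e k = x k]. *)
exists (\bigcup_(j in [set` undup (supp z)]) (inr j |` (inl @` letter (rel j)))
         `|` inl @` letter w).
  rewrite finite_setU; split; last exact/finite_image/letter_finite.
  apply: bigcup_finite => [|j _]; first exact: finite_seq.
  by rewrite finite_setU; split => //; exact/finite_image/letter_finite.
move=> B x [xe xr].
have <- : eval x (dword d) = eval x w.
  rewrite /d (rhom_sum _ _ (evd _ x)) /eval; clear -xe ide.
  have {xe} : forall k, letter w k -> x k *> e k = x k by move=> k wk; apply: xe; right; exists k.
  elim: w => [|q w IH] xe; first by rewrite !big_nil.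
  rewrite !big_cons IH; last by move=> k wk; apply: xe; right.
  by rewrite [X in X + _ = _]eval_single // -rmod_actA xe //; left.
rewrite -zd {1}(single_sum z idf) (rhom_sum _ _ hh) (rhom_sum _ _ (evd _ x)) big1_seq //.
move=> j /andP[_ jz]; rewrite sg // (rhomZ _ _ hh) (rhomZ _ _ (evd _ x)).
rewrite [X in X *> _](_ : _ = 0) ?rmod_act0 //; apply: xr.
  by left; exists j => //; left.
by move=> k jk; left; exists j => //; right; exists k.
Qed.

(** * Directed colimits *)

Section Colimits.
Variables (R : rngType) (d : Order.disp_t) (I : porderType d) (S : dsystem R I).
Variables (M : rmodType R) (c : forall i, S i -> M).
Hypotheses (dirI : directed I) (uS : forall i, unitary (S i)) (uM : unitary M).
Hypothesis (colim : is_colimit (J := setT) (fun i _ => @c i)).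

Lemma colimit_hom i : rhom (@c i).
Proof. exact: (colim.1.1 i Logic.I). Qed.

Lemma colimit_compat i j (ij : (i <= j)%O) x : c (ds_map S ij x) = c x.
Proof. exact: (colim.1.2 i j Logic.I Logic.I ij x). Qed.

Definition stage_image : set M := [set y | exists i (x : S i), c x = y].

Fact stage_image0 : stage_image 0.
Proof. by have [[i _] _] := dirI; exists i, 0; exact/rhom0/colimit_hom. Qed.

Fact stage_imageB y z : stage_image y -> stage_image z -> stage_image (y - z).
Proof.
move=> [i [x <-]] [j [t <-]]; have [k ik jk] := dirI.2 i j.
exists k, (ds_map S ik x - ds_map S jk t).
by rewrite (rhomB _ _ (colimit_hom k)) !colimit_compat.
Qed.

Fact stage_image_act y a : stage_image y -> stage_image (y *> a).
Proof. by move=> [i [x <-]]; exists i, (x *> a); exact/rhomZ/colimit_hom. Qed.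

(** The zero map and the projection modulo the union of the images of the stages agree on every
    stage, so uniqueness in the universal property identifies them. *)
Lemma colimit_stage y : exists i (x : S i), c x = y.
Proof.
pose U := Submodule stage_image0 stage_imageB stage_image_act.
have hpi := quot_pi_hom U.
have [|h [_ huniq]] := colim.2 (quotmod U) (fun i _ _ => 0)
  (unitary_surj hpi (@quot_pi_surj _ _ U) uM).
  by split=> // i _; exact: rhom_zero.
have e1 : h = fun=> 0 by apply: huniq; split=> //; exact: rhom_zero.
have e2 : h = (@quot_pi _ _ U : M -> quotmod U).
  by apply: huniq; split=> // i _ x; apply/quot_pi0; exists i, x.
by apply/(quot_pi0 U y); move: (congr1 (fun f => f y) e2); rewrite e1 => <-.
Qed.

(* The colimit is realized as the families that are eventually coherent modulo
   those that are eventually zero. *)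
Definition thread_set : set (dprod S) :=
  [set t | exists i, forall j (ij : (i <= j)%O), t j = ds_map S ij (t i)].

Fact thread0 : thread_set 0.
Proof. by have [[i _] _] := dirI; exists i => j ij; rewrite (rhom0 (ds_map_hom S ij)). Qed.

Fact threadB s t : thread_set s -> thread_set t -> thread_set (s - t).
Proof.
move=> [i hi] [j hj]; have [k ik jk] := dirI.2 i j; exists k => l kl.
have il := le_trans ik kl; have jl := le_trans jk kl.
rewrite [LHS](_ : _ = s l - t l) // [in RHS](_ : (s - t) k = s k - t k) //.
rewrite (rhomB _ _ (ds_map_hom S kl)) (hi k ik) (hj k jk).
rewrite (ds_map_comp ik kl il) (ds_map_comp jk kl jl).
by rewrite (hi l il) (hj l jl).
Qed.

Fact thread_act t a : thread_set t -> thread_set (t *> a).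
Proof.
move=> [i hi]; exists i => j ij.
by rewrite [LHS](_ : _ = t j *> a) // (hi j ij) -(rhomZ _ _ (ds_map_hom S ij)).
Qed.

Definition threads := Submodule thread0 threadB thread_act.

Local Notation tval t := (submod_val (t : submod threads) : dprod S).

Definition null_thread_set : set (submod threads) :=
  [set t | exists i, forall j, (i <= j)%O -> tval t j = 0].

Fact null_thread0 : null_thread_set 0.
Proof. by have [[i _] _] := dirI; exists i. Qed.

Fact null_threadB s t : null_thread_set s -> null_thread_set t -> null_thread_set (s - t).
Proof.
move=> [i hi] [j hj]; have [k ik jk] := dirI.2 i j; exists k => l kl.
rewrite [LHS](_ : _ = tval s l - tval t l) //.
by rewrite hi ?hj ?subrr //; [exact: le_trans jk kl|exact: le_trans ik kl].
Qed.

Fact null_thread_act t a : null_thread_set t -> null_thread_set (t *> a).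
Proof.
move=> [i hi]; exists i => j ij.
by rewrite [LHS](_ : _ = tval t j *> a) // hi // rmod_act0.
Qed.

Definition null_threads := Submodule null_thread0 null_threadB null_thread_act.

Definition thread i (x : S i) : dprod S :=
  fun j => if pselect (i <= j)%O is left ij then ds_map S ij x else 0.

Lemma threadE i (x : S i) j (ij : (i <= j)%O) : thread x j = ds_map S ij x.
Proof.
by rewrite /thread; case: pselect => // ij'; rewrite (Prop_irrelevance ij ij').
Qed.

Lemma thread_in i (x : S i) : thread_set (thread x).
Proof.
exists i => j ij; rewrite (threadE _ ij) (threadE _ (lexx i)).
by rewrite (ds_map_comp (lexx i) ij ij).
Qed.

Definition stage_thread i (x : S i) : quotmod null_threads :=
  quot_pi null_threads (@submod_in _ _ threads _ (thread_in x)).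

Lemma stage_thread_hom i : rhom (@stage_thread i).
Proof.
have hpi := quot_pi_hom null_threads.
split=> [x y|a x]; rewrite /stage_thread -?(rhomD _ _ hpi) -?(rhomZ _ _ hpi).
  congr quot_pi; apply: submod_val_inj; apply: functional_extensionality_dep => j.
  rewrite [RHS](_ : _ = thread x j + thread y j) //= /thread.
  by case: pselect => [ij|_]; rewrite ?(rhomD _ _ (ds_map_hom S ij)) ?addr0.
congr quot_pi; apply: submod_val_inj; apply: functional_extensionality_dep => j.
rewrite [RHS](_ : _ = thread x j *> a) //= /thread.
by case: pselect => [ij|_]; rewrite ?(rhomZ _ _ (ds_map_hom S ij)) ?rmod_act0.
Qed.

Lemma threads_unitary : unitary (quotmod null_threads).
Proof.
move=> y; have [t <-] := quot_pi_surj y; have [i hi] := submod_inE t.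
suff -> : (quot_pi null_threads t : quotmod null_threads) = stage_thread (tval t i).
  by apply: (unitary_part_hom (stage_thread_hom i)); exact: uS.
apply/quot_pi_eq; exists i => j ij.
rewrite [LHS](_ : _ = tval t j - thread (tval t i) j) //.
by rewrite (threadE _ ij) (hi j ij) subrr.
Qed.

(** The universal property maps M to the explicit colimit, where a stage element is zero only if it
    is eventually zero. This test object has to be unitary. *)
Lemma colimit_zero i (x : S i) : c x = 0 -> exists j (ij : (i <= j)%O), ds_map S ij x = 0.
Proof.
move=> cx; have [|h [[hh hg] _]] := colim.2 (quotmod null_threads)
  (fun i _ => @stage_thread i) threads_unitary.
  split=> [j _|j k _ _ jk z]; first exact: stage_thread_hom.
  apply/quot_pi_eq; exists k => l kl.
  rewrite [LHS](_ : _ = thread (ds_map S jk z) l - thread z l) //.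
  by rewrite (threadE _ kl) (threadE _ (le_trans jk kl)) (ds_map_comp jk kl (le_trans jk kl)) subrr.
have : stage_thread x = 0 by rewrite -(hg i Logic.I) cx rhom0.
move=> /quot_pi0[k hk]; have [j ij kj] := dirI.2 i k; exists j, ij.
by rewrite -(threadE x ij); exact: hk.
Qed.

Lemma colimit_eq i (x y : S i) : c x = c y ->
  exists j (ij : (i <= j)%O), ds_map S ij x = ds_map S ij y.
Proof.
move=> xy; have [|j [ij h]] := @colimit_zero i (x - y).
  by rewrite (rhomB _ _ (colimit_hom i)) xy subrr.
exists j, ij; apply/eqP; rewrite -subr_eq0; apply/eqP.
by rewrite -(rhomB _ _ (ds_map_hom S ij)).
Qed.

End Colimits.

(** * Presentations along continuous systems *)

Lemma dep_choice (A : Type) (T : A -> Type) (P : forall a, T a -> Prop) :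
  (forall a, exists v, P a v) -> exists v : forall a, T a, forall a, P a (v a).
Proof. by move=> h; exists (fun a => sval (cid (h a))) => a; exact: svalP (cid (h a)). Qed.

Section Lifting.
Variables (R : rngType) (X Y : Type) (e : X -> R) (rel : Y -> seq (X * R)).
Variables (DD : rmodType R -> Prop).
Implicit Types (A B D E : rmodType R) (P Q : set (X + Y)).

(** For P inside Q this is DD-injectivity of M(P) -> M(Q). It is stated for arbitrary Q so that
    [strong] can quantify over all sets of a given size. *)
Definition dinj P Q : Prop := forall D, DD D -> forall x : X -> D, model e rel P x ->
  exists2 y : X -> D, model e rel Q y & agree P x y.

(* The module presented by [P] is projective with respect to the surjections
   with kernel in [DD] and unitary domain [E]; a homomorphism into the quotient
   of [E] by the image of [i] is given by a [P]-model modulo that image. *)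
Definition lifts P : Prop := forall D, DD D -> forall E (i : D -> E) (x : X -> E),
  unitary E -> rhom i -> injective i ->
  (forall k, P (inl k) -> exists d, i d = x k *> e k - x k) ->
  (forall j, P (inr j) -> (forall k, letter (rel j) k -> P (inl k)) ->
    exists d, i d = eval x (rel j)) ->
  exists2 y : X -> E, model e rel P y & forall k, P (inl k) -> exists d, i d = y k - x k.

Lemma dinj_sub P Q Q' : Q' `<=` Q -> dinj P Q -> dinj P Q'.
Proof.
move=> sub h D DDD x mx; have [y my xy] := h D DDD x mx; exists y => //.
exact: model_sub my.
Qed.

Lemma dinj_set0 Q : dinj set0 Q.
Proof. by move=> D _ x _; exists (fun=> 0) => //; exact: model0. Qed.

Lemma lifts_set0 : lifts set0.
Proof. by move=> D _ E i x *; exists (fun=> 0) => //; exact: model0. Qed.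

Definition universal P A (u : X -> A) : Prop :=
  model e rel P u /\ forall B (x : X -> B), unitary B -> model e rel P x ->
    exists2 h : A -> B, rhom h & agree P (h \o u) x.

(** The model modulo i(D) is a homomorphism h from [A] to E/i(D). Pulling E back along h gives an
    extension of [A] by D, and its section composed with the projection to E is the lift. *)
Lemma universal_lifts P A (u : X -> A) : (forall D, DD D -> unitary D) ->
  left_perp DD A -> universal P u -> lifts P.
Proof.
move=> uDD [uA perpA] [mu univ] D DDD E i x uE hi inj_i xe xr.
pose U := image_submodule hi; pose pi := quot_pi U : E -> quotmod U.
have hpi : rhom pi := quot_pi_hom U.
have [h hh hu] : exists2 h : A -> quotmod U, rhom h & agree P (h \o u) (pi \o x).
  apply: univ; first exact: unitary_surj hpi (@quot_pi_surj _ _ U) uE.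
  split=> [k Pk|j Pj hj] /=.
    rewrite -(rhomZ _ _ hpi); apply/quot_pi_eq; exact: xe.
  rewrite -(rhom_eval _ _ hpi); apply/quot_pi0; exact: xr.
pose T := [set p : (A * E)%type | h p.1 = pi p.2].
have T0 : T 0 by rewrite /T /= (rhom0 hh) (rhom0 hpi).
have TB p q : T p -> T q -> T (p - q).
  by rewrite /T /= => hp hq; rewrite (rhomB _ _ hh) (rhomB _ _ hpi) hp hq.
have TZ p a : T p -> T (p *> a).
  by rewrite /T /= => hp; rewrite (rhomZ _ _ hh) (rhomZ _ _ hpi) hp.
pose V : rmodType R := submod (Submodule T0 TB TZ).
have Ti d : T (0, i d).
  by rewrite /T /= (rhom0 hh); apply/esym/quot_pi0; exists d.
pose inj d : V := @submod_in _ _ (Submodule T0 TB TZ) _ (Ti d).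
pose proj (p : V) : A := (submod_val p : (A * E)%type).1.
have hinj : rhom inj.
  split=> [d d'|a d]; apply: submod_val_inj; congr pair => /=.
  - by rewrite addr0.
  - by rewrite (rhomD _ _ hi).
  - by rewrite rmod_act0.
  - by rewrite (rhomZ _ _ hi).
have hproj : rhom proj by split.
have injinj : injective inj by move=> d d' /(congr1 (@submod_val _ _ _)) [/inj_i].
have surj a : exists p, proj p = a.
  have [b hb] := quot_pi_surj (h a).
  have Tab : T (a, b) by rewrite /T /= -hb.
  by exists (@submod_in _ _ (Submodule T0 TB TZ) _ Tab).
have ex p : proj p = 0 <-> exists d, inj d = p.
  split=> [p0|[d <-] //].
  have Tp : T (submod_val p) := submod_inE p.
  have /quot_pi0[d id] : pi (submod_val p : (A * E)%type).2 = 0.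
    by rewrite -Tp [X in h X]p0 (rhom0 hh).
  by exists d; apply: submod_val_inj; rewrite [RHS]surjective_pairing; congr pair.
have uV : unitary V.
  by apply: (unitary_extension hinj hproj) => // [p /ex //|]; exact: uDD.
have [s hs sP] := (Ext1_eq0_splits uA (uDD D DDD)).1 (perpA D DDD)
  (Extension uV hinj hproj injinj surj ex).
have hsnd : rhom (fun p : V => (submod_val p : (A * E)%type).2) by split.
exists ((fun p : V => (submod_val p : (A * E)%type).2) \o (s \o u)).
  by apply: (model_hom hsnd); exact: (model_hom hs).
move=> k Pk; apply/(quot_pi_eq U) => /=.
have Tp : T (submod_val (s (u k) : V)) := submod_inE (s (u k) : V).
rewrite -[LHS]Tp -[RHS](hu k Pk) /=; congr h; exact: sP.
Qed.

End Lifting.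

(** * Back-and-forth between subsets of the presentation and stages of a system *)

Section System.
Variables (R : rngType) (X Y : Type) (e : X -> R) (rel : Y -> seq (X * R)).
Variables (M : rmodType R) (m : X -> M).
Hypotheses (M_unitary : unitary M) (e_idem : forall k, idempotent_elt (e k)).
Hypothesis M_pres : presents e rel m.
Variable DD : rmodType R -> Prop.
Variables (W L : Type) (lt : L -> L -> Prop).
Hypotheses (infW : infinite_set [set: W]) (succL : succ_wo W lt).
Variables (d : Order.disp_t) (I : porderType d) (S : dsystem R I) (c : forall i, S i -> M).
Hypothesis sys : almost_D_projective_system DD L c.

Let dirI : directed I. Proof. by have [] := sys. Qed.
Let contS : continuous_system L S. Proof. by have [] := sys. Qed.
Let presS i : lt_presented L (S i). Proof. by have [_ _ /(_ i)[]] := sys. Qed.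
Let perpS i : left_perp DD (S i). Proof. by have [_ _ /(_ i)[]] := sys. Qed.
Let uS i : unitary (S i). Proof. by have [] := perpS i. Qed.
Let colimS : is_colimit (J := setT) (fun i _ => @c i). Proof. by have [] := sys. Qed.
Let hc i : rhom (@c i). Proof. exact: colimit_hom colimS i. Qed.
Let hS i j (ij : (i <= j)%O) : rhom (ds_map S ij). Proof. exact: ds_map_hom. Qed.
Let cS i j (ij : (i <= j)%O) x : c (ds_map S ij x) = c x.
Proof. exact: colimit_compat colimS _ _ ij x. Qed.

Lemma image_short_chain (Q : Type) (lq : Q -> Q -> Prop) (A : set Q) (f : Q -> I) :
  strict_wo lq -> A !=set0 -> A #<= [set: W] ->
  (forall a b, A a -> A b -> lq a b -> (f a <= f b)%O) -> short_chain L (f @` A).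
Proof.
move=> [wf tr tri] [a0 Aa0] smA mono; split.
- by exists (f a0), a0.
- apply: antisymmetric_wo_chain => [x y _ _|B BJ [x Bx]]; first exact: le_anti.
  have [|a [Aa Ba] min] := @strict_wo_min _ _ (A `&` [set a | f a \in B]) wf.
    by have [a Aa fa] := set_mem (BJ x Bx); exists a; split=> //=; rewrite fa.
  exists (f a); split=> // y By; have [b Ab fb] := set_mem (BJ y By).
  rewrite -fb; have [ab|->|ba] := tri a b => //; first exact: mono.
  by case: (min b _ ba); split=> //=; rewrite fb.
- exact: (small_lt succL (small_image f smA)).
Qed.

Lemma system_chain_sup (Q : Type) (lq : Q -> Q -> Prop) (A : set Q) (f : Q -> I) :
  strict_wo lq -> A #<= [set: W] -> (forall a b, A a -> A b -> lq a b -> (f a <= f b)%O) ->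
  exists s, forall a, A a -> (f a <= s)%O.
Proof.
move=> wo smA mono; case: (pselect (A !=set0)) => [ne|no]; last first.
  by have [[i _] _] := dirI; exists i => a Aa; case: no; exists a.
have [[s [ub _]] _] := contS (image_short_chain wo ne smA mono).
by exists s => a Aa; apply: ub; exists a.
Qed.

(** Directedness bounds finite families and continuity bounds chains. A well-order on [Q] therefore
    serves to build recursively an increasing family g above f, whose supremum is the bound. *)
Lemma system_upper_bound (Q : Type) (A : set Q) (f : Q -> I) :
  A #<= [set: W] -> exists i, forall a, A a -> (f a <= i)%O.
Proof.
move=> smA; have [lq wo] := exists_strict_wo Q; have [wf tr tri] := wo.
have [[i0 _] dir] := dirI.
have [||a g IH|g gP] := @wf_dependent_choice Q I lq (fun a g i => A a ->
    (f a <= i)%O /\ forall b, A b -> lq b a -> (g b <= i)%O) wf.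
- by exists.
- by move=> a g g' i gg' h Aa; have [h1 h2] := h Aa; split=> // b Ab ba; rewrite -gg' ?h2.
- have [s hs] := @system_chain_sup Q lq (A `&` seg lq a) g wo
    (small_subset (fun x => @proj1 _ _) smA)
    (fun b b' Ab Ab' bb' => (IH b' Ab'.2 Ab'.1).2 b Ab.1 bb').
  have [i h1 h2] := dir (f a) s; exists i => Aa; split=> // b Ab ba.
  exact: le_trans (hs b (conj Ab ba)) h2.
have [s hs] := @system_chain_sup Q lq A g wo smA
  (fun b b' Ab Ab' bb' => (gP b' Ab').2 b Ab bb').
by exists s => a Aa; apply: le_trans (hs a Aa); exact: (gP a Aa).1.
Qed.

(** [st_fun] lifts the generators in [st_set] to the stage; its values elsewhere carry no
    meaning. *)
Record state := State {
  st_set : set (X + Y);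
  st_idx : I;
  st_fun : X -> S st_idx
}.

Definition valid (t : state) : Prop :=
  [/\ st_set t #<= [set: W], model e rel (st_set t) (@st_fun t)
    & agree (st_set t) (@c _ \o @st_fun t) m].

Definition st_le (t t' : state) : Prop :=
  st_set t `<=` st_set t' /\ exists ij : (st_idx t <= st_idx t')%O,
    agree (st_set t) (ds_map S ij \o @st_fun t) (@st_fun t').

(* The map from the stage of [t] to that of [t'] factors through the module
   presented by the set of [t']. *)
Definition st_step (t t' : state) : Prop :=
  st_le t t' /\ forall (A : rmodType R) (x : X -> A), unitary A -> model e rel (st_set t') x ->
    exists v : S (st_idx t) -> A, [/\ rhom v, agree (st_set t) (v \o @st_fun t) x
      & forall h : S (st_idx t') -> A, rhom h -> agree (st_set t') (h \o @st_fun t') x ->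
        forall (ij : (st_idx t <= st_idx t')%O) y, h (ds_map S ij y) = v y].

Lemma st_le_refl t : st_le t t.
Proof. by split=> //; exists (lexx _) => k _ /=; rewrite ds_map_id. Qed.

Lemma st_le_trans t t' t'' : st_le t t' -> st_le t' t'' -> st_le t t''.
Proof.
move=> [s [ij h]] [s' [jk h']]; split; first exact: subset_trans s s'.
exists (le_trans ij jk) => k Pk /=.
by rewrite -(ds_map_comp ij jk) -(h' k (s _ Pk)) /= -(h k Pk).
Qed.

Lemma st_le_step t t' t'' : st_le t t' -> st_step t' t'' -> st_step t t''.
Proof.
move=> le [le' h]; split; first exact: st_le_trans le le'.
move=> A x uA mx; have [v [hv vx univ]] := h A x uA mx.
have [s [ij ag]] := le; have [_ [jk _]] := le'.
exists (v \o ds_map S ij); split=> [|k Pk|g hg gx ik y] /=.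
- exact: rhom_comp.
- by rewrite [ds_map _ _ _](ag k Pk); exact: vx k (s _ Pk).
- by rewrite -(univ g hg gx jk) (ds_map_comp ij jk ik).
Qed.

Lemma st_step_le t t' t'' : st_step t t' -> st_le t' t'' -> st_step t t''.
Proof.
move=> [le h] le'; split; first exact: st_le_trans le le'.
have [s [jk ag]] := le'; have [_ [ij _]] := le.
move=> A x uA mx; have [v [hv vx univ]] := h A x uA (model_sub s mx).
exists v; split=> // g hg gx ik y.
rewrite -(ds_map_comp ij jk ik); apply: (univ (g \o ds_map S jk)).
  exact: rhom_comp.
by move=> k Pk /=; rewrite [ds_map _ _ _](ag k Pk); exact: gx k (s _ Pk).
Qed.

Lemma valid_init : exists t, valid t.
Proof.
have [[i _] _] := dirI; exists (@State set0 i (fun=> 0)).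
by split=> //=; exact: card_ge0.
Qed.

(** Stage i has at most |W| generators and relations. P' receives the letters of words w a
    expressing these generators in M, and finite sets forcing the needed identities in every model;
    a model of P' then induces a homomorphism from stage i. Finally a stage i2 is taken so late that
    it contains a compatible model of P'. *)
Lemma step_exists t (U : set (X + Y)) : valid t -> U #<= [set: W] ->
  exists t', [/\ valid t', st_step t t' & U `<=` st_set t'].
Proof.
case: t => P i u [/= smP mu um] smU.
have [mm gen compact] := M_pres.
have [X' [Y' [e' [rel' [s [sX sY ide presT]]]]]] := presented_presents (presS i).
have {}sX := succ_wo_le succL sX; have {}sY := succ_wo_le succL sY.
have [ms gens _] := presT.
(* Acting by the idempotent [e' a] makes the value of the word fixed by [e' a] in every module, and
   not only in M. *)
have wP a : exists w, eval m w = c (s a) /\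
    forall (A : rmodType R) (x : X -> A), eval x w *> e' a = eval x w.
  have [w we] := gen (c (s a)); exists (wact w (e' a)); split=> [|A x].
    by rewrite eval_act we -(rhomZ _ _ (hc i)) ms.1.
  by rewrite !eval_act rmod_actA ide.
have {wP} [w wP] := choice wP.
have wcs : (fun a => eval m (w a)) = (fun a => c (s a)).
  by apply: funext => a; exact: (wP a).1.
have FP j : exists F : set (X + Y), finite_set F /\
    forall (A : rmodType R) (x : X -> A), model e rel F x -> eval x (wsubst w (rel' j)) = 0.
  have [|F fF hF] := compact (wsubst w (rel' j)); last by exists F.
  by rewrite eval_subst wcs -(rhom_eval s _ (hc i)) ms.2 // (rhom0 (hc i)).
have {FP} [F FP] := choice FP.
(* G k forces the expression of u k through the generators s of the stage to evaluate to x k in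
   every model; this gives the agreement of v with x on P. *)
have GP k : exists G : set (X + Y), P (inl k) -> finite_set G /\ exists w',
    eval s w' = u k /\ forall (A : rmodType R) (x : X -> A), model e rel G x ->
      eval x (wsubst w w') = x k *> e k.
  case: (pselect (P (inl k))) => [Pk|]; last by exists set0.
  have [w' we] := gens (u k).
  have [|G fG hG] := compact (wsubst w w' ++ [:: (k, - e k)]).
    rewrite eval_cat eval_subst wcs -(rhom_eval s _ (hc i)) we eval_cons eval_nil addr0.
    by rewrite rmod_actNr mm.1 // -(um k Pk) subrr.
  exists G => _; split=> //; exists w'; split=> // A x /hG /eqP.
  by rewrite eval_cat eval_cons eval_nil addr0 rmod_actNr subr_eq0 => /eqP.
have {GP} [G GP] := choice GP.
pose PX := [set k | P (inl k)].
have smPX : PX #<= [set: W].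
  apply: card_le_trans smP; apply: (@card_le_rel _ _ _ _ (fun k z => z = inl k)) => [k Pk|].
    by exists (inl k).
  by move=> k k' z _ _ -> [].
pose P' := P `|` (U `|` (\bigcup_(a in [set: X']) (inl @` letter (w a)) `|`
  (\bigcup_(j in [set: Y']) F j `|` \bigcup_(k in PX) G k))).
have smP' : P' #<= [set: W].
  apply: small_setU => //; apply: small_setU => //; apply: small_setU => //; last first.
    apply: small_setU => //.
    - by apply: small_bigcup => // j _; apply: small_finite => //; exact: (FP j).1.
    - by apply: small_bigcup => // k Pk; apply: small_finite => //; exact: (GP k Pk).1.
  - apply: small_bigcup => // a _; apply: small_finite => //.
    exact/finite_image/letter_finite.
have wP' a k : letter (w a) k -> P' (inl k).
  by move=> wk; right; right; left; exists a => //; exists k.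
have FP' j : F j `<=` P' by move=> q Fq; right; right; right; left; exists j.
have GP' k : P (inl k) -> G k `<=` P' by move=> Pk q Gq; right; right; right; right; exists k.
have zP k : exists jz : {j : I & S j}, c (projT2 jz) = m k.
  by have [j [z zm]] := colimit_stage dirI M_unitary colimS (m k); exists (existT _ j z).
have {zP} [z zP] := choice zP.
pose PX' := [set k | P' (inl k)]; pose PY' := [set j | P' (inr j)].
have smPX' : PX' #<= [set: W].
  apply: card_le_trans smP'; apply: (@card_le_rel _ _ _ _ (fun k z => z = inl k)) => [k Pk|].
    by exists (inl k).
  by move=> k k' z' _ _ -> [].
have smPY' : PY' #<= [set: W].
  apply: card_le_trans smP'; apply: (@card_le_rel _ _ _ _ (fun k z => z = inr k)) => [k Pk|].
    by exists (inr k).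
  by move=> k k' z' _ _ -> [].
have [i0 i0P] := @system_upper_bound X PX' (fun k => projT1 (z k)) smPX'.
have [i1 ii1 i01] := dirI.2 i i0.
(* Generators in P keep the image of u, so that the new state extends the old one. A new generator
   gets a preimage of m k, acted on by e k so that e k fixes it. *)
have u1P k : exists y : S i1, P' (inl k) -> [/\ c y = m k, y *> e k = y &
    P (inl k) -> y = ds_map S ii1 (u k)].
  case: (pselect (P (inl k))) => [Pk|nPk].
    exists (ds_map S ii1 (u k)) => _; split=> //; first by rewrite cS; exact: um.
    by rewrite -(rhomZ _ _ (hS ii1)) mu.1.
  case: (pselect (P' (inl k))) => [Pk|]; last by exists 0.
  have ki1 := le_trans (i0P k Pk) i01.
  exists (ds_map S ki1 (projT2 (z k) *> e k)) => _; split=> //.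
    by rewrite cS (rhomZ _ _ (hc _)) zP mm.1.
  by rewrite -(rhomZ _ _ (hS ki1)) rmod_actA e_idem.
have {u1P} [u1 u1P] := choice u1P.
have u1m w' : (forall k, letter w' k -> P' (inl k)) -> c (eval u1 w') = eval m w'.
  move=> hw; rewrite (rhom_eval _ _ (hc i1)); apply: eval_ext => k /hw Pk.
  by have [] := u1P k Pk.
(* Each relation of P', and each identification in [KX], holds only from some later stage on; there
   are at most |W| of them, so one stage serves for all. *)
have KY j : exists l, (i1 <= l)%O /\ forall l' (il : (i1 <= l')%O), (l <= l')%O ->
    (forall k, letter (rel j) k -> P' (inl k)) -> ds_map S il (eval u1 (rel j)) = 0.
  case: (pselect (forall k, letter (rel j) k -> P' (inl k))) => [hj|no]; last by exists i1.
  have [|l [il h]] := @colimit_zero _ _ _ _ _ _ dirI uS colimS i1 (eval u1 (rel j)).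
    by rewrite u1m // mm.2.
  exists l; split=> // l' il' ll' _.
  by rewrite -(ds_map_comp il ll' il') h (rhom0 (hS ll')).
have {KY} [lY lYP] := choice KY.
have KX a : exists l, (i1 <= l)%O /\ forall l' (il : (i1 <= l')%O) (ii : (i <= l')%O),
    (l <= l')%O -> ds_map S il (eval u1 (w a)) = ds_map S ii (s a).
  have [|l [il h]] := @colimit_eq _ _ _ _ _ _ dirI uS colimS i1
    (eval u1 (w a)) (ds_map S ii1 (s a)).
    by rewrite u1m ?cS; [exact: (wP a).1|exact: wP'].
  exists l; split=> // l' il' ii ll'.
  by rewrite -(ds_map_comp il ll' il') h (ds_map_comp ii1 il (le_trans ii1 il)) ds_map_comp.
have {KX} [lX lXP] := choice KX.
have [j1 j1P] := @system_upper_bound Y PY' lY smPY'.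
have [j2 j2P] := @system_upper_bound X' setT lX sX.
have [j3 i1j3 j1j3] := dirI.2 i1 j1; have [i2 j32 j22] := dirI.2 j3 j2.
have i12 := le_trans i1j3 j32; have ii2 := le_trans ii1 i12.
pose u2 := ds_map S i12 \o u1.
have u2w a : eval u2 (w a) = ds_map S ii2 (s a).
  rewrite -(rhom_eval _ _ (hS i12)); apply: (lXP a).2.
  exact: le_trans (j2P a Logic.I) j22.
exists (@State P' i2 u2); split.
- split=> //=; first split=> [k Pk|j Pj hj].
  + by rewrite /u2 /= -(rhomZ _ _ (hS i12)); have [_ -> _] := u1P k Pk.
  + rewrite -(rhom_eval _ _ (hS i12)); apply: (lYP j).2 => //.
    exact: le_trans (le_trans (j1P j Pj) j1j3) j32.
  + by move=> k Pk /=; rewrite /u2 /= cS; have [-> _ _] := u1P k Pk.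
- split=> [|A x uA mx /=].
    split=> /= [|]; first by move=> q Pq; left.
    exists ii2 => k Pk; rewrite /u2 /=; have [|_ _ ->//] := u1P k; first by left.
    by rewrite (ds_map_comp ii1 i12 ii2).
  pose y a := eval x (w a).
  have my : model e' rel' setT y.
    split=> [a _|j _ _]; first exact: (wP a).2.
    by rewrite -eval_subst; apply: (FP j).2; exact: model_sub (@FP' j) mx.
  have [v hv vs] := presents_hom presT my.
  exists v; split=> // [k Pk /=|h hh hu ij y'].
    have [_ [w' [<- hw']]] := GP k Pk.
    rewrite (rhom_eval _ _ hv) (_ : v \o s = y); last exact/funext.
    rewrite -eval_subst hw' ?mx.1 //; first by left.
    by apply: model_sub mx; exact: GP'.
  have hf := rhom_comp (hS ij) hh.
  have -> // : v = h \o ds_map S ij; apply: presents_hom_eq presT hv hf _ => a /=.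
  rewrite (Prop_irrelevance ij ii2) -u2w vs (rhom_eval _ _ hh) /y.
  by apply: eval_ext => k /wP' Pk; rewrite hu.
- by move=> q Uq; right; left.
Qed.

(** Stages and presented modules factor alternately through each other along the chain, so both
    systems have the same colimit; by continuity it is the stage at the supremum. *)
Lemma chain_limit (Q : Type) (lq : Q -> Q -> Prop) (A : set Q) (t : Q -> state) :
  strict_wo lq -> A !=set0 -> A #<= [set: W] -> (forall a, A a -> valid (t a)) ->
  (forall a b, A a -> A b -> lq a b -> st_le (t a) (t b)) ->
  exists t', [/\ valid t', st_set t' = \bigcup_(a in A) st_set (t a),
    forall a, A a -> st_le (t a) t'
    & (forall a, A a -> exists2 b, A b & lq a b) ->
      (forall a b, A a -> A b -> lq a b -> st_step (t a) (t b)) ->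
      universal e rel (st_set t') (@st_fun t')].
Proof.
move=> wo neA smA vt let_; have [wf tr tri] := wo.
have mono a b : A a -> A b -> lq a b -> (st_idx (t a) <= st_idx (t b))%O.
  by move=> Aa Ab /(let_ a b Aa Ab)[_ []].
have leq_ a b : A a -> A b -> lq a b \/ a = b -> st_le (t a) (t b).
  by move=> Aa Ab [/let_|->]; [exact|exact: st_le_refl].
have short := image_short_chain wo neA smA mono.
have [[s [ub lub]] colim] := contS short.
have ubA a : A a -> (st_idx (t a) <= s)%O by move=> Aa; apply: ub; exists a.
have {colim} [[hg comp] colim] := colim s ub lub.
pose P := \bigcup_(a in A) st_set (t a).
have uP k : exists z : S s, forall a, A a -> st_set (t a) (inl k) ->
    forall ij : (st_idx (t a) <= s)%O, z = ds_map S ij (st_fun (t a) k).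
  case: (pselect (exists2 a, A a & st_set (t a) (inl k))) => [[a Aa ak]|no]; last first.
    by exists 0 => a Aa ak; case: no; exists a.
  exists (ds_map S (ubA a Aa) (st_fun (t a) k)) => b Ab bk ij.
  have key x y : A x -> A y -> st_le (t x) (t y) -> st_set (t x) (inl k) ->
      forall (xs : (st_idx (t x) <= s)%O) (ys : (st_idx (t y) <= s)%O),
      ds_map S xs (st_fun (t x) k) = ds_map S ys (st_fun (t y) k).
    by move=> Ax Ay [_ [xy ag]] xk xs ys; rewrite -(ag k xk) /= (ds_map_comp xy ys xs).
  case: (tri a b) => ab.
  - by apply: key => //; apply: leq_ => //; left.
  - by apply: key => //; apply: leq_ => //; right.
  - by apply/esym/key => //; apply: leq_ => //; left.
have {uP} [u uP] := choice uP.
have uA a (Aa : A a) : agree (st_set (t a)) (ds_map S (ubA a Aa) \o st_fun (t a)) u.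
  by move=> k ak /=; exact/esym/uP.
exists (@State P s u); split=> //=.
- split=> /=.
  + by apply: small_bigcup => // a Aa; have [] := vt a Aa.
  + apply: model_bigcup => [a b Aa Ab|a Aa].
      case: (tri a b) => ab.
      * by exists b => // z [/(leq_ _ _ Aa Ab (or_introl ab)).1|].
      * by exists b => // z [|//]; rewrite ab.
      * by exists a => // z [//|/(leq_ _ _ Ab Aa (or_introl ab)).1].
    apply: (model_agree (uA a Aa)); apply: model_hom => //.
    by have [] := vt a Aa.
  + move=> k [a Aa ak] /=; rewrite (uP k a Aa ak (ubA a Aa)) cS.
    by have [_ _ /(_ k ak)] := vt a Aa.
- move=> a Aa; split=> /= [z az|]; first by exists a.
  by exists (ubA a Aa); exact: uA.
move=> nomax steps; split.
  apply: model_bigcup => [a b Aa Ab|a Aa].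
    case: (tri a b) => ab.
    + by exists b => // z [/(leq_ _ _ Aa Ab (or_introl ab)).1|].
    + by exists b => // z [|//]; rewrite ab.
    + by exists a => // z [//|/(leq_ _ _ Ab Aa (or_introl ab)).1].
  by apply: (model_agree (uA a Aa)); apply: model_hom => //; have [] := vt a Aa.
move=> B x uB mx.
have mxa a : A a -> model e rel (st_set (t a)) x.
  by move=> Aa; apply: model_sub mx => z az; exists a.
have vP a : exists v : S (st_idx (t a)) -> B, A a -> [/\ rhom v,
    agree (st_set (t a)) (v \o st_fun (t a)) x & exists2 b, A b & lq a b /\
      forall c' (h : S (st_idx (t c')) -> B), A c' -> lq b c' -> rhom h ->
        agree (st_set (t c')) (h \o st_fun (t c')) x ->
        forall (ij : (st_idx (t a) <= st_idx (t c'))%O) y, h (ds_map S ij y) = v y].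
  case: (pselect (A a)) => [Aa|]; last by exists (fun=> 0).
  have [b Ab ab] := nomax a Aa; have st := steps a b Aa Ab ab.
  have [v [hv va hvu]] := st.2 B x uB (mxa b Ab).
  exists v => _; split=> //; exists b => //; split=> // c' h Ac bc hh hx ij y.
  have [sub [jk ag]] := let_ b c' Ab Ac bc; have [_ [aij _]] := st.1.
  rewrite -(hvu (h \o ds_map S jk) _ _ aij) /=; first by rewrite (ds_map_comp aij jk ij).
    exact: rhom_comp.
  by move=> k bk /=; rewrite [ds_map _ _ _](ag k bk); exact: hx k (sub _ bk).
have {vP} [v vP] := dep_choice vP.
have max a b : A a -> A b -> exists c', [/\ A c', a = c' \/ lq a c' & b = c' \/ lq b c'].
  by case: (tri a b) => ab Aa Ab; [exists b|exists b|exists a]; split=> //; by [left|right].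
have above a b : A a -> A b -> exists c', [/\ A c', lq a c' & lq b c'].
  move=> Aa Ab; have [c1 [A1 h1 h2]] := max a b Aa Ab; have [c2 A2 h3] := nomax c1 A1.
  by exists c2; split=> //; [case: h1 => [->|/tr]; last exact|case: h2 => [->|/tr]; last exact].
(* v a is characterized only through stages beyond its witness b, so v a and v b are compared at a
   stage beyond both witnesses. *)
have vcompat a b (Aa : A a) (Ab : A b) : exists c', [/\ A c', lq a c', lq b c' &
    (forall (ij : (st_idx (t a) <= st_idx (t c'))%O) y, v c' (ds_map S ij y) = v a y) /\
    (forall (ij : (st_idx (t b) <= st_idx (t c'))%O) y, v c' (ds_map S ij y) = v b y)].
  have [_ _ [a' Aa' [aa' ha]]] := vP a Aa; have [_ _ [b' Ab' [bb' hb]]] := vP b Ab.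
  have [c' [Ac ac bc]] := above a' b' Aa' Ab'; have [hvc hvcx _] := vP c' Ac.
  exists c'; split=> //; [exact: tr ac|exact: tr bc|].
  by split=> ij y; [exact: ha|exact: hb].
(* The colimit is indexed by the image of [A] in [I], where several a may share an index: g takes v
   at one of them and is compared with the others further up. *)
have gP j (Jj : ((fun a => st_idx (t a)) @` A) j) : exists g : S j -> B, rhom g /\
    forall a, A a -> forall (ij : (j <= st_idx (t a))%O) y, g y = v a (ds_map S ij y).
  case: Jj => a Aa <-{j}; exists (v a); have [hva _ _] := vP a Aa; split=> // b Ab ij y.
  have [c' [Ac ac bc [h1 h2]]] := vcompat a b Aa Ab.
  have jk := mono _ _ Ab Ac bc.
  by rewrite -h2 (ds_map_comp ij jk (le_trans ij jk)) h1.
have {gP} [g gP] := dep_choice (fun j => dep_choice (gP j)).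
have [|h [[hh hgE] _]] := colim B g uB.
  split=> [j Jj|j k Jj Jk jk y]; first exact: (gP j Jj).1.
  have [a Aa ak] := Jk; have ka : (k <= st_idx (t a))%O by rewrite ak.
  rewrite ((gP k Jk).2 a Aa ka) ((gP j Jj).2 a Aa (le_trans jk ka)).
  by rewrite (ds_map_comp jk ka (le_trans jk ka)).
exists h => // k [a Aa ak] /=.
have Ja : ((fun a => st_idx (t a)) @` A) (st_idx (t a)) by exists a.
rewrite (uP k a Aa ak (ub _ Ja)) hgE ((gP _ Ja).2 a Aa (lexx _)) ds_map_id.
by have [_ + _] := vP a Aa; apply.
Qed.

End System.

(** * Continuous chains *)

Section Chains.
Variables (R : rngType) (X Y : Type) (e : X -> R) (rel : Y -> seq (X * R)).
Variables (DD : rmodType R -> Prop).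
Implicit Types (P Q : set (X + Y)).

Lemma model_inj P (D E : rmodType R) (i : D -> E) (z : X -> D) :
  rhom i -> injective i -> model e rel P (i \o z) -> model e rel P z.
Proof.
move=> hi inj [ze zr]; split=> [k Pk|j Pj hj]; apply: inj; first by rewrite rhomZ // ze.
by rewrite rhom_eval // zr // rhom0.
Qed.

Lemma model_glue (A : Type) (lt : A -> A -> Prop) (P : A -> set (X + Y)) (J : set A)
    (E : rmodType R) (f : A -> X -> E) :
  strict_wo lt -> (forall a b, lt a b -> P a `<=` P b) ->
  (forall a, J a -> model e rel (P a) (f a)) ->
  (forall a b, J a -> J b -> lt a b -> agree (P a) (f a) (f b)) ->
  exists2 y : X -> E, model e rel (\bigcup_(a in J) P a) y &
    forall a, J a -> agree (P a) (f a) y.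
Proof.
move=> [_ _ tri] mono mf coh.
have yP k : exists z, forall a, J a -> P a (inl k) -> f a k = z.
  case: (pselect (exists2 a, J a & P a (inl k))) => [[a Ja ak]|no]; last first.
    by exists 0 => a Ja ak; case: no; exists a.
  exists (f a k) => b Jb bk; have [ab|<-//|ba] := tri a b.
    by rewrite (coh a b).
  by rewrite -(coh b a).
have [y {}yP] := choice yP.
have ya a : J a -> agree (P a) (f a) y by move=> Ja k ak; exact: yP.
exists y => //; apply: model_bigcup => [a b Ja Jb|a Ja].
  have [ab|ab|ba] := tri a b.
  - by exists b => // z [/(mono _ _ ab)|].
  - by exists b => // z [|//]; rewrite ab.
  - by exists a => // z [//|/(mono _ _ ba)].
by apply: model_agree (ya a Ja) _; exact: mf.
Qed.

(** A recursion as in Eklof's lemma, choosing lifts over P a that extend all earlier ones. Just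
    after b, any lift over P a is corrected by a D-valued model so as to extend the one over P b; at
    a limit the earlier lifts are glued. *)
Lemma lifts_chain (A : Type) (lt : A -> A -> Prop) (P : A -> set (X + Y)) :
  strict_wo lt -> (forall a b, lt a b -> P a `<=` P b) ->
  (forall a, lifts e rel DD (P a)) -> (forall a b, lt a b -> dinj e rel DD (P a) (P b)) ->
  (forall a, (exists b, lt b a) -> (forall b, lt b a -> exists2 c, lt b c & lt c a) ->
    P a `<=` \bigcup_(b in seg lt a) P b) ->
  lifts e rel DD (\bigcup_a P a).
Proof.
move=> wo mono lP dP cont D DDD E i x uE hi inj xe xr; have [wf tr tri] := wo.
pose near a (y : X -> E) := forall k, P a (inl k) -> exists d, i d = y k - x k.
have base a : exists2 y, model e rel (P a) y & near a y.
  apply: (lP a D DDD E i x uE hi inj) => [k ak|j aj hj]; first by apply: xe; exists a.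
  by apply: xr => [|k jk]; exists a => //; exact: hj.
have [||a f IH|f fP] := @wf_dependent_choice A (X -> E) lt (fun a f y =>
    [/\ model e rel (P a) y, near a y & forall b, lt b a -> agree (P b) (f b) y]) wf.
- exact: inhabits (fun=> 0).
- by move=> a f g y fg [my ny h]; split=> // b ba; rewrite -fg //; exact: h.
- have [y0 my0 ny0] := base a.
  case: (pselect (exists b, lt b a)) => [exb|no]; last first.
    by exists y0; split=> // b ba; case: no; exists b.
  case: (pselect (exists2 b, lt b a & ~ exists2 c, lt b c & lt c a)) => [[b ba max]|nomax].
    have [mb nb hb] := IH b ba.
    (* y0 and f b both lift x over P b, so they differ by a model with values in D; DD-injectivity
       extends it to P a. *)
    have zP k : exists d, P b (inl k) -> i d = y0 k - f b k.
      case: (pselect (P b (inl k))) => [bk|]; last by exists 0.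
      have [d1 e1] := ny0 k (mono _ _ ba _ bk); have [d2 e2] := nb k bk.
      by exists (d1 - d2) => _; rewrite (rhomB _ _ hi) e1 e2 opprB addrA subrK.
    have [z {}zP] := choice zP.
    have mz : model e rel (P b) z.
      apply: (model_inj hi inj); apply: (@model_agree _ _ _ _ _ _ _ (fun k => y0 k - f b k)).
        by move=> k bk /=; rewrite zP.
      by apply: model_sub_fun => //; exact: model_sub (mono _ _ ba) my0.
    have [z' mz' zz'] := dP b a ba D DDD z mz.
    have yb : agree (P b) (f b) (fun k => y0 k - i (z' k)).
      by move=> k bk; rewrite -zz' // zP // subKr.
    exists (fun k => y0 k - i (z' k)); split.
    + by apply: model_sub_fun => //; exact: (model_hom hi).
    + move=> k ak; have [d0 e0] := ny0 k ak; exists (d0 - z' k).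
      by rewrite (rhomB _ _ hi) e0 addrAC.
    + move=> c ca; have [cb|->//|bc] := tri c b.
        by apply: agree_trans (hb c cb) _; exact: agree_sub (mono _ _ cb) yb.
      by case: max; exists c.
  have lim b : lt b a -> exists2 c, lt b c & lt c a.
    by move=> ba; apply: contrapT => h; apply: nomax; exists b.
  have [|b c ba ca bc|y my yf] := @model_glue A lt P (seg lt a) E f wo mono.
  + by move=> b /IH[].
  + by have [_ _] := IH c ca; exact.
  exists y; split=> // [|k ak]; first exact: model_sub (cont a exb lim) my.
  have [b ba bk] := cont a exb lim _ ak; have [_ nb _] := IH b ba.
  by rewrite -(yf b ba k bk); exact: nb.
- have [|b c _ _ bc|y my yf] := @model_glue A lt P setT E f wo mono.
  + by move=> b _; have [] := fP b.
  + by have [_ _] := fP c; exact.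
  exists y => // k [a _ ak]; rewrite -(yf a Logic.I k ak).
  by have [_ na _] := fP a; exact: na.
Qed.

Lemma lifts_Ext1_eq0 (M : rmodType R) (m : X -> M) : unitary M ->
  (forall D, DD D -> unitary D) -> presents e rel m -> lifts e rel DD setT ->
  forall D, DD D -> Ext1_eq0 M D.
Proof.
move=> uM uDD presM lM D DDD; apply/Ext1_eq0_splits => //; first exact: uDD.
move=> E; have hp := ext_proj_hom E.
have [x xm] := choice (fun k => @ext_surjective _ _ _ E (m k)).
have [mm _ _] := presM.
have mE : ext_proj E \o x = m by exact: funext.
have [k _|j _ _|y my yx] := lM D DDD (ext_mod E) (ext_inj E) x (@ext_unitary _ _ _ E)
  (ext_inj_hom E) (@ext_injective _ _ _ E).
- by apply/ext_exact; rewrite (rhomB _ _ hp) (rhomZ _ _ hp) xm mm.1 // subrr.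
- by apply/ext_exact; rewrite (rhom_eval _ _ hp) mE mm.2.
have [s hs sm] := presents_hom presM my.
exists s => // z.
have e1 := presents_hom_eq presM (rhom_comp hs hp) (@rhom_id _ M).
rewrite -[LHS]/((ext_proj E \o s) z) e1 // => k /=; rewrite sm.
have /ext_exact : exists d, ext_inj E d = y k - x k by exact: yx.
by rewrite (rhomB _ _ hp) xm => /eqP; rewrite subr_eq0 => /eqP.
Qed.

End Chains.

(** * Filter-closed classes *)

Section FilterClosed.
Variables (R : rngType) (hR : enough_idempotents R).
Variables (X Y : Type) (e : X -> R) (rel : Y -> seq (X * R)).
Hypothesis e_idem : forall k, idempotent_elt (e k).
Variables (DD : rmodType R -> Prop) (DD_closed : filter_closed DD).
Variables (W : Type) (infW : infinite_set [set: W]).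
Variables (Q0 Q : set (X + Y)).
Hypotheses (Q0Q : Q0 `<=` Q) (liftQ : lifts e rel DD Q) (dinjQ : dinj e rel DD Q0 Q).

Definition vanishing (D : rmodType R) (x : X -> D) : Prop := forall k, Q0 (inl k) -> x k = 0.

(** Everything is relative to Q0: subtracting an extension provided by [dinjQ] reduces an extension
    problem with prescribed values on Q0 to one with zero values there. *)
Definition bad (P : set (X + Y)) (D : rmodType R) (g : X -> D) : Prop :=
  [/\ DD D, model e rel P g, vanishing g &
    ~ exists y : X -> D, [/\ model e rel Q y, vanishing y & agree P g y]].

Lemma choose_bad (P : set (X + Y)) : exists D : {D : rmodType R & X -> D},
  [/\ DD (projT1 D), model e rel P (projT2 D), vanishing (projT2 D)
    & ~ bad P (projT2 D) -> forall (D' : rmodType R) (g : X -> D'), ~ bad P g].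
Proof.
case: (pselect (exists (D : rmodType R) (g : X -> D), bad P g)) => [[D [g bg]]|no].
  by exists (existT _ D g); case: (bg) => h1 h2 h3 _; split.
have [[D DDD] _] := DD_closed; exists (existT _ D (fun=> 0)); split=> //=.
  exact: model0.
by move=> _ D' g bg; apply: no; exists D', g.
Qed.

Definition tail_filter : set_system (set (X + Y)) :=
  [set B | exists P0, [/\ P0 `<=` Q, P0 #<= [set: W] &
    forall P, P0 `<=` P -> P `<=` Q -> P #<= [set: W] -> B P]].

Lemma tail_filter_filter : Filter tail_filter.
Proof.
split.
- by exists set0; split=> //; exact: card_ge0.
- move=> B B' [P0 [h1 h2 h3]] [P1 [k1 k2 k3]]; exists (P0 `|` P1); split.
  + by move=> z [/h1|/k1].
  + exact: small_setU.
  + move=> P; rewrite subUset => -[s s'] PQ smP; split; [exact: h3|exact: k3].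
- by move=> B B' BB' [P0 [h1 h2 h3]]; exists P0; split=> // P *; apply: BB'; exact: h3.
Qed.

(* Choose for every small P a model g_P of P, zero on Q0, that has no extension
   to Q zero on Q0, if there is one.  Modulo tails the g_P define a model of Q in
   the product of their targets.  It lifts to a model of Q in the product, whose
   coordinate at P extends g_P as soon as P is closed under [club]; so g_P was
   not bad. *)
Lemma filter_club : exists club : set (X + Y) -> set (X + Y),
  [/\ forall P, P #<= [set: W] -> club P #<= [set: W], forall P, club P `<=` Q
    & forall Pn : nat -> set (X + Y), (forall n, Pn n `<=` Q) ->
      (forall n, Pn n #<= [set: W]) -> (forall n, club (Pn n) `<=` Pn n.+1) ->
      forall D, DD D -> forall x : X -> D, model e rel Q0 x ->
        model e rel (\bigcup_n Pn n) x ->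
        exists y : X -> D, [/\ model e rel Q y, agree Q0 x y & agree (\bigcup_n Pn n) x y]].
Proof.
have [Dg DgP] := choice choose_bad.
pose A P := projT1 (Dg P); pose g P : X -> A P := projT2 (Dg P).
pose FF := tail_filter_filter.
pose V := dprod A.
pose E : rmodType R := submod (unitary_submodule (V : rmodType R)).
pose B : rmodType R := Defs.filter_prod A FF.
have DB : DD B by apply: DD_closed.2 => P; have [] := DgP P.
have iota_in (b : B) : unitary_part (V : rmodType R) (submod_val b).
  by have [] := submod_inE b.
pose iota (b : B) : E := @submod_in _ _ (unitary_submodule (V : rmodType R)) _ (iota_in b).
have hi : rhom iota by split=> [b b'|a b]; apply: submod_val_inj.
have inj : injective iota.
  move=> b b2 h; apply: submod_val_inj; exact: (congr1 (fun y : E => submod_val y : V) h).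
pose co P (y : E) : A P := (submod_val y : V) P.
have hco P : rhom (co P) by split.
have iotaP (y : E) : tail_filter [set P | co P y = 0] -> exists b, iota b = y.
  move=> Fy; have Hy : filter_prod_set tail_filter (submod_val y : V).
    by split=> //; exact: submod_inE y.
  by exists (@submod_in _ _ (Submodule _ _ _) _ Hy); exact: submod_val_inj.
have iota0 b : tail_filter [set P | co P (iota b) = 0] by have [_] := submod_inE b.
(* The default 0 keeps x zero on Q0. Acting by e k puts the family into the unitary part of the
   product and does not change g P k when k is in P. *)
pose x0 k : V := fun P => if pselect (P (inl k)) then g P k else 0.
pose x k : E := act_in (x0 k : V : rmodType R) (e k).
have xE P k : co P (x k) = (if pselect (P (inl k)) then g P k else 0) *> e k by [].
have uE : unitary E by exact: unitary_part_unitary.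
have xe k : x k *> e k = x k.
  apply: submod_val_inj; apply: functional_extensionality_dep => P.
  rewrite -[LHS]/(co P (x k) *> e k) -[RHS]/(co P (x k)) xE rmod_actA.
  by rewrite e_idem.
have gP P k : P (inl k) -> co P (x k) = g P k.
  by move=> Pk; have [_ [ge _] _ _] := DgP P; rewrite xE; case: pselect => //= _; exact: ge.
have [k _|j Qj hj|y my yx] := liftQ DB (x := x) uE hi inj.
- by exists 0; rewrite (rhom0 hi) xe subrr.
- apply: iotaP; exists (inr j |` (inl @` letter (rel j))); split.
  + by move=> z [->//|[k jk <-]]; exact: hj.
  + apply: small_finite => //; rewrite finite_setU; split=> //.
    exact/finite_image/letter_finite.
  + move=> P sub PQ smP; have [_ [_ gr] _ _] := DgP P.
    have Pl k : letter (rel j) k -> P (inl k) by move=> jk; apply: sub; right; exists k.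
    rewrite /= (rhom_eval _ _ (hco P)) -(gr j) //; last by apply: sub; left.
    by apply: eval_ext => k /Pl /gP.
have x_van k : Q0 (inl k) -> x k = 0.
  move=> Qk; apply: submod_val_inj; apply: functional_extensionality_dep => P.
  rewrite -[LHS]/(co P (x k)) xE; have [_ _ van _] := DgP P.
  by case: pselect => _ /=; rewrite ?[g P k]van // rmod_act0.
(* y agrees with x only modulo B, so on Q0 its values lie in B. Extending this B-valued model to Q
   by [dinjQ] and subtracting it makes y vanish on Q0. *)
have yz k : exists b, Q0 (inl k) -> iota b = y k.
  case: (pselect (Q0 (inl k))) => [Qk|]; last by exists 0.
  by have [b bE] := yx k (Q0Q Qk); exists b => _; rewrite bE x_van // subr0.
have [z0 z0P] := choice yz.
have mz0 : model e rel Q0 z0.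
  apply: (model_inj hi inj); apply: (@model_agree _ _ _ _ _ _ _ y); last exact: model_sub my.
  by move=> k Qk; rewrite /= z0P.
have [z mz z0z] := dinjQ DB mz0.
pose y' k := y k - iota (z k).
have my' : model e rel Q y' by apply: model_sub_fun => //; exact: model_hom.
have van' : vanishing y' by move=> k Qk; rewrite /y' -z0z // z0P // subrr.
have PkP k : exists P0, Q (inl k) -> [/\ P0 `<=` Q, P0 #<= [set: W] &
    forall P, P0 `<=` P -> P `<=` Q -> P #<= [set: W] -> co P (y' k) = co P (x k)].
  case: (pselect (Q (inl k))) => [Qk|]; last by exists set0.
  have [b bE] := yx k Qk; have [P0 [h1 h2 h3]] := iota0 (b - z k).
  exists P0 => _; split=> // P *; apply/eqP; rewrite -subr_eq0 -(rhomB _ _ (hco P)).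
  by rewrite /y' addrAC -bE -(rhomB _ _ hi); apply/eqP; exact: h3.
have [Pk {}PkP] := choice PkP.
exists (fun P => \bigcup_(k in [set k | P (inl k) /\ Q (inl k)]) Pk k); split.
- move=> P smP; apply: small_bigcup => // [|k [_ Qk]]; last by have [] := PkP k Qk.
  apply: card_le_trans smP; apply: (@card_le_rel _ _ _ _ (fun k z => z = inl k)) => [k []|].
    by exists (inl k).
  by move=> k k' t _ _ -> [].
- by move=> P t [k [_ Qk]]; have [h _ _] := PkP k Qk; exact: h.
move=> Pn PnQ smPn clubP; set P := \bigcup_n Pn n.
have PQ : P `<=` Q by move=> t [n _ /PnQ].
have smP : P #<= [set: W].
  by apply: small_bigcup => //; exact: small_nat.
have nobad : forall (D : rmodType R) (h : X -> D), ~ bad P h.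
  have [DA mg vg] := DgP P; apply => -[_ _ _]; apply.
  exists (fun k => co P (y' k)); split.
  - exact: (model_hom (hco P)).
  - by move=> k Qk; rewrite van' // (rhom0 (hco P)).
  - move=> k PPk; have [n _ Pnk] := PPk; have Qk := PQ _ PPk.
    have [h1 h2 h3] := PkP k Qk; rewrite h3 ?gP //.
    by move=> t tk; exists n.+1 => //; apply: clubP; exists k.
move=> D DDD u mu0 muP.
have [y1 my1 uy1] := dinjQ DDD mu0.
have mg : model e rel P (fun k => u k - y1 k).
  by apply: model_sub_fun => //; exact: model_sub my1.
have [y2 [my2 van2 ag2]] : exists y2 : X -> D,
    [/\ model e rel Q y2, vanishing y2 & agree P (fun k => u k - y1 k) y2].
  apply: contrapT => no; apply: (nobad D (fun k => u k - y1 k)); split=> //.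
  by move=> k Qk; rewrite uy1 // subrr.
exists (fun k => y1 k + y2 k); split.
- exact: model_add.
- by move=> k Qk; rewrite van2 // addr0 uy1.
- by move=> k Pk'; rewrite -ag2 // addrC subrK.
Qed.

End FilterClosed.

(** * Chains of states and their unions *)

Section SystemChains.
Variables (R : rngType) (X Y : Type) (e : X -> R) (rel : Y -> seq (X * R)).
Variables (M : rmodType R) (m : X -> M).
Hypotheses (M_unitary : unitary M) (e_idem : forall k, idempotent_elt (e k)).
Hypothesis M_pres : presents e rel m.
Variable DD : rmodType R -> Prop.
Hypothesis DD_unitary : forall D, DD D -> unitary D.
Variables (W L : Type) (lt : L -> L -> Prop).
Hypotheses (infW : infinite_set [set: W]) (succL : succ_wo W lt).
Variables (d : Order.disp_t) (I : porderType d) (S : dsystem R I) (c : forall i, S i -> M).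
Hypothesis sys : almost_D_projective_system DD L c.
Variables (Q : Type) (lq : Q -> Q -> Prop) (A : set Q) (t : Q -> state X Y S).
Hypotheses (wo : strict_wo lq) (smA : A #<= [set: W]).
Hypothesis vt : forall a, A a -> valid e rel m W c (t a).

Lemma next_state (U : set (X + Y)) :
  (forall a b, A a -> A b -> lq a b -> st_step e rel (t a) (t b)) -> U #<= [set: W] ->
  exists t', [/\ valid e rel m W c t', forall a, A a -> st_step e rel (t a) t'
    & U `<=` st_set t'].
Proof.
move=> steps smU.
have [t0 vt0 le0] : exists2 t0, valid e rel m W c t0 & forall a, A a -> st_le (t a) t0.
  case: (pselect (A !=set0)) => [neA|no].
    have [|t0 [vt0 _ le0 _]] := chain_limit infW succL sys wo neA smA vt.
      by move=> a b Aa Ab /(steps a b Aa Ab)[].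
    by exists t0.
  have [t0 vt0] := valid_init e rel m W sys; exists t0 => // a Aa.
  by case: no; exists a.
have [t' [vt' st Ut]] := step_exists M_unitary e_idem M_pres infW succL sys vt0 smU.
by exists t'; split=> // a Aa; exact: st_le_step (le0 a Aa) st.
Qed.

Hypotheses (neA : A !=set0) (nomax : forall a, A a -> exists2 b, A b & lq a b).
Hypothesis steps : forall a b, A a -> A b -> lq a b -> st_step e rel (t a) (t b).

Let U := \bigcup_(a in A) st_set (t a).

Lemma chain_universal : exists2 t', valid e rel m W c t' &
  st_set t' = U /\ universal e rel U (@st_fun _ _ _ _ _ _ t').
Proof.
have [|t' [vt' tE _ univ]] := chain_limit infW succL sys wo neA smA vt.
  by move=> a b Aa Ab /(steps Aa Ab)[].
by exists t' => //; split=> //; rewrite /U -tE; exact: univ.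
Qed.

Lemma chain_lifts : lifts e rel DD U.
Proof.
have [t' _ [_]] := chain_universal; apply: universal_lifts => //.
by have [_ _ /(_ (st_idx t'))[]] := sys.
Qed.

Lemma chain_dinj : (forall i, D_injective DD (@c i)) -> dinj e rel DD U setT.
Proof.
move=> cD D DDD x mx; have [t' [_ _ cm] [tE [mu univ]]] := chain_universal.
have [g hg gx] := univ D x (DD_unitary DDD) mx.
have [h hh hc] := cD _ D DDD g hg.
have [mm _ _] := M_pres.
exists (h \o m); first exact: model_hom.
by move=> k Uk; rewrite /= -(cm k) ?tE //= hc; exact/esym/gx.
Qed.

End SystemChains.

(** * Strong sets *)

Definition strong (R : rngType) (X Y : Type) (e : X -> R) (rel : Y -> seq (X * R))
    (DD : rmodType R -> Prop) (W : Type) (P : set (X + Y)) : Prop :=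
  [/\ P #<= [set: W], lifts e rel DD P
    & forall P', P' #<= [set: W] -> dinj e rel DD P P'].

Section Strong.
Variables (R : rngType) (hR : enough_idempotents R).
Variables (X Y : Type) (e : X -> R) (rel : Y -> seq (X * R)).
Variables (M : rmodType R) (m : X -> M).
Hypotheses (M_unitary : unitary M) (e_idem : forall k, idempotent_elt (e k)).
Hypothesis M_pres : presents e rel m.
Variable DD : rmodType R -> Prop.
Hypotheses (DD_unitary : forall D, DD D -> unitary D) (DD_closed : filter_closed DD).
Variables (W L L2 : Type) (lt : L -> L -> Prop) (lt2 : L2 -> L2 -> Prop).
Hypotheses (infW : infinite_set [set: W]) (succL : succ_wo W lt) (succL2 : succ_wo L lt2).
Variables (d : Order.disp_t) (I : porderType d) (S : dsystem R I) (c : forall i, S i -> M).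
Hypothesis sys : almost_D_projective_system DD L c.
Variables (d2 : Order.disp_t) (I2 : porderType d2) (S2 : dsystem R I2)
  (c2 : forall i, S2 i -> M).
Hypothesis sys2 : almost_D_projective_system DD L2 c2.

(* Otherwise there is an increasing continuous chain P_x, x in L, whose terms at
   limits lift but do not DD-inject into the next term.  Its union Q, built along
   with a chain in the system of size L, lifts, so by [filter_club] some of
   these terms do DD-inject into Q. *)
Lemma strong_cofinal (U : set (X + Y)) : U #<= [set: W] ->
  exists2 P, U `<=` P & strong e rel DD W P.
Proof.
move=> smU; apply: contrapT => no.
have infL := succ_wo_infinite infW succL.
have [wo segW nLW] := succL; have [wf tr tri] := wo.
have WL : [set: W] #<= [set: L] := (succ_wo_lt succL).1.
have [l0] : inhabited L.
  by apply: contrapT => nL; apply: infL; rewrite (_ : [set: L] = set0) //;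
    apply/seteqP; split=> // x; case: nL; exists.
have up (x y : L) : exists2 z, lt x z & lt y z.
  have [z zP] := small_bounded_nat infW succL (fun n => if n is 0 then x else y).
  by exists z; [exact: (zP 0)|exact: (zP 1)].
have witP P : exists P', P' #<= [set: W] /\
    (P #<= [set: W] -> U `<=` P -> lifts e rel DD P -> ~ dinj e rel DD P P').
  case: (pselect (exists P', P' #<= [set: W] /\ ~ dinj e rel DD P P')).
    by move=> [P' [smP' nd]]; exists P'.
  move=> none; exists set0; split; first exact: card_ge0.
  move=> smP UP lP _; apply: no; exists P => //; split=> // P' smP'.
  by apply: contrapT => nd; apply: none; exists P'.
have [wit {}witP] := choice witP.
have enP (Q : set (X + Y)) : exists f : X + Y -> L, Q #<= [set: L] ->
    forall x y, Q x -> Q y -> f x = f y -> x = y.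
  case: (pselect (Q #<= [set: L])) => [QL|]; last by exists (fun=> l0).
  by have [f [_ fi]] := card_le_fun QL (inhabits l0); exists f.
have [en {}enP] := choice enP.
pose T := (state X Y S * state X Y S2)%type.
pose Pm (f : L -> T) x := \bigcup_(y in seg lt x) st_set (f y).1.
(* Bookkeeping: a set of the second chain may have |L| elements and enters the first chain
   gradually, at x only with its elements numbered below x. Thus both chains have the same union. *)
pose early (f : L -> T) x := \bigcup_(y in seg lt x)
  [set z | st_set (f y).2 z /\ lt (en (st_set (f y).2) z) x].
pose good x (f : L -> T) (t : T) := [/\
  valid e rel m W c t.1 /\ valid e rel m L c2 t.2,
  forall y, lt y x -> st_step e rel (f y).1 t.1 /\ st_step e rel (f y).2 t.2,
  U `|` (wit (Pm f x) `|` early f x) `<=` st_set t.1 & st_set t.1 `<=` st_set t.2].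
have [|||f fP] := @wf_dependent_choice L T lt good wf.
- have [t vt] := valid_init e rel m W sys; have [t' vt'] := valid_init e rel m L sys2.
  exact: inhabits (t, t').
- move=> x f g t fg [h1 h2 h3 h4]; split=> //; first by move=> y yx; rewrite -fg //; exact: h2.
  have -> : Pm g x = Pm f x by apply: eq_bigcupr => y yx; rewrite fg.
  have -> // : early g x = early f x by apply: eq_bigcupr => y yx; rewrite fg.
- move=> x f IH.
  have vf y : seg lt x y -> valid e rel m W c (f y).1 by move=> yx; have [[]] := IH y yx.
  have vf2 y : seg lt x y -> valid e rel m L c2 (f y).2 by move=> yx; have [[]] := IH y yx.
  have sf y z : seg lt x y -> seg lt x z -> lt y z -> st_step e rel (f y).1 (f z).1.
    by move=> yx zx yz; have [_ /(_ y yz)[]] := IH z zx.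
  have sf2 y z : seg lt x y -> seg lt x z -> lt y z -> st_step e rel (f y).2 (f z).2.
    by move=> yx zx yz; have [_ /(_ y yz)[]] := IH z zx.
  have smN : U `|` (wit (Pm f x) `|` early f x) #<= [set: W].
    apply: small_setU => //; apply: small_setU => //; first exact: (witP _).1.
    apply: small_bigcup => // y yx; apply: card_le_trans (segW x).
    have [smy _ _] := vf2 y yx.
    apply: (@card_le_rel _ _ _ _ (fun z l => en (st_set (f y).2) z = l)) => [z [_ zx]|].
      by exists (en (st_set (f y).2) z).
    by move=> z z' l [zy _] [zy' _] <- /esym; exact: enP.
  have [t [vt st sub]] := next_state M_unitary e_idem M_pres infW succL sys wo (segW x) vf sf smN.
  have [smt _ _] := vt.
  have [t2 [vt2 st2 sub2]] := next_state M_unitary e_idem M_pres infL succL2 sys2 wo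
    (card_le_trans (segW x) WL) vf2 sf2 (card_le_trans smt WL).
  by exists (t, t2); split=> // y yx; split; [exact: st|exact: st2].
have vf y : valid e rel m W c (f y).1 by have [[]] := fP y.
have vf2 y : valid e rel m L c2 (f y).2 by have [[]] := fP y.
have sf y z : lt y z -> st_step e rel (f y).1 (f z).1.
  by move=> yz; have [_ /(_ y yz)[]] := fP z.
have sf2 y z : lt y z -> st_step e rel (f y).2 (f z).2.
  by move=> yz; have [_ /(_ y yz)[]] := fP z.
have incl y : st_set (f y).1 `<=` st_set (f y).2 by have [] := fP y.
pose Q := \bigcup_y st_set (f y).2.
have liftQ : lifts e rel DD Q.
  apply: (chain_lifts DD_unitary infL succL2 sys2 wo) => //.
  - by exists l0.
  - by move=> x _; have [z xz _] := up x x; exists z.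
  - by move=> x y _ _; exact: sf2.
have QP z : Q z -> exists y, st_set (f y).1 z.
  move=> [y _ yz]; have [x yx ex] := up y (en (st_set (f y).2) z).
  by exists x; have [_ _ + _] := fP x; apply; right; right; exists y.
have PQ x : Pm f x `<=` Q by move=> z [y _ /incl yz]; exists y.
have smPm x : Pm f x #<= [set: W].
  by apply: small_bigcup => // y _; have [] := vf y.
have [club [smclub clubQ clubP]] := filter_club hR e_idem DD_closed infW (sub0set Q)
  liftQ (@dinj_set0 _ _ _ _ _ _ Q).
have nxtP x : exists x', lt x x' /\ club (Pm f x) `<=` Pm f x'.
  have zP z : exists y, club (Pm f x) z -> st_set (f y).1 z.
    case: (pselect (club (Pm f x) z)) => [/clubQ/QP[y]|]; last by exists l0.
    by exists y.
  have [g gP] := choice zP.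
  have [b bP] := small_bounded infW succL g (smclub _ (smPm x)).
  have [x' xx' bx'] := up x b; exists x'; split=> // z zc.
  by exists (g z); [exact: tr (bP z zc) bx'|exact: gP].
have [nxt {}nxtP] := choice nxtP.
pose s n := iter n nxt l0.
have sS n : lt (s n) (s n.+1) by exact: (nxtP _).1.
(* x is a limit of cofinality omega. The sets [Pm f (s n)] absorb each other's [club], so their
   union [Pm f x] DD-injects into Q and hence into its supposed counterexample, which stage x has
   absorbed. *)
have [x xs min] : exists2 x, (forall n, lt (s n) x) & forall y, (forall n, lt (s n) y) -> ~ lt y x.
  exact: strict_wo_min wf (small_bounded_nat infW succL s).
have below y : lt y x -> exists n, lt y (s n).
  move=> yx; apply: contrapT => none; apply: (min y) => // n.
  have [//|ny|yn] := tri (s n) y; last by case: none; exists n.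
  by case: none; exists n.+1; rewrite -ny.
have PmE : Pm f x = \bigcup_n Pm f (s n).
  apply/seteqP; split=> z [y].
    by move=> /below[n yn] yz; exists n => //; exists y.
  by move=> _ [y' y's y'z]; exists y' => //; exact: tr y's (xs y).
have liftP : lifts e rel DD (Pm f x).
  apply: (chain_lifts DD_unitary infW succL sys wo) => //.
  - by exists (s 0); exact: xs.
  - by move=> y /below[n yn]; exists (s n) => //; exact: xs.
  - by move=> y z _ _; exact: sf.
have UP : U `<=` Pm f x.
  move=> z Uz; exists (s 0); first exact: xs.
  by have [_ _ + _] := fP (s 0); apply; left.
have [_ nd] := witP (Pm f x); apply: (nd (smPm x) UP liftP).
apply: (@dinj_sub _ _ _ _ _ _ _ Q).
  move=> z wz; exists x => //; apply: incl.
  by have [_ _ + _] := fP x; apply; right; left.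
move=> D DDD u mu; have [||y [my _ ag]] := clubP (fun n => Pm f (s n)) (fun n => PQ _)
  (fun n => smPm _) (fun n => (nxtP _).2) D DDD u.
- exact: model_sub mu.
- by rewrite -PmE.
- by rewrite PmE; exists y.
Qed.

End Strong.

(** * Singular compactness *)

(** The common form of both parts, so that one interleaving serves them: positions are states of a
    system in (b), and strong sets with closure demands in (a). *)
Record strategy (Z W : Type) := Strategy {
  pos : Type;
  pset : pos -> set Z;
  move : pos -> pos -> Prop;
  start : pos;
  pset_small : forall t, pset t #<= [set: W];
  move_sub : forall t t', move t t' -> pset t `<=` pset t';
  reply : forall t U, U #<= [set: W] -> exists2 t', move t t' & U `<=` pset t'
}.

Section Interleaving.
Variables (Z K A : Type) (la : A -> A -> Prop) (B : A -> set K).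
Local Notation W a := {y | B a y}.
Hypothesis infW : forall a, infinite_set [set: W a].
Hypothesis monoB : forall a b, la a b -> B a `<=` B b.
Hypothesis coverB : forall y, exists a, B a y.
Hypothesis smA : forall a, [set: A] #<= [set: W a].
Hypothesis contB : forall a, (exists b, la b a) ->
  (forall b, la b a -> exists2 c, la b c & la c a) ->
  forall y, B a y -> exists2 b, la b a & B b y.
Variables (iota : Z -> K) (iota_inj : injective iota).
Variable F : forall a, strategy Z (W a).
Variable demand : forall a, pos (F a) -> A -> set Z -> set Z.
Hypothesis demand_small : forall a (t : pos (F a)) b V,
  V #<= [set: W b] -> demand t b V #<= [set: W b].

(* Since the part of each stage of P a that is numbered by B b goes into the next
   stage of P b, and B a is the union of the smaller B b at a limit a, the P a
   are continuous at limits although none of their finite stages need be. *)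
Lemma interleave : exists t : nat -> forall a, pos (F a),
  let P a := \bigcup_n pset (t n a) in
  [/\ forall a, t 0 a = start (F a),
      forall n a, move (t n a) (t n.+1 a),
      forall n a b, demand (t n a) b (pset (t n b)) `<=` pset (t n.+1 b) &
   [/\ forall a b, la a b -> P a `<=` P b,
      \bigcup_a P a = setT &
      forall a, (exists b, la b a) -> (forall b, la b a -> exists2 c, la b c & la c a) ->
        P a `<=` \bigcup_(b in seg la a) P b]].
Proof.
have enP (V : set Z) (a : A) : exists f : Z -> K, V #<= [set: W a] ->
    (forall z, V z -> B a (f z)) /\ (forall x y, V x -> V y -> f x = f y -> x = y).
  case: (pselect (V #<= [set: W a])) => [Va|]; last by exists iota.
  have [y _] : exists y : W a, True.
    by have [y _] := infinite_setN0 (@infW a); exists y.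
  have [f [fB fi]] := card_le_fun (card_le_trans Va (card_sig_le (B a))) (inhabits (sval y)).
  by exists f.
have {enP} [en enP] := dep_choice (fun V => dep_choice (enP V)).
(* The four pieces yield covering, monotonicity, continuity and the demands. The third ranges over
   all a, also those above b; it stays small because only elements numbered by B b are taken and
   there are at most |W b| indices. *)
pose need (t : forall a, pos (F a)) b : set Z :=
  [set z | B b (iota z)] `|` (\bigcup_(a in [set a | la a b]) pset (t a) `|`
  (\bigcup_a [set z | pset (t a) z /\ B b (en (pset (t a)) a z)] `|`
   \bigcup_a demand (t a) b (pset (t b)))).
have needP t b : need t b #<= [set: W b].
  apply: small_setU => //; last apply: small_setU => //; last apply: small_setU => //.
  - apply: card_le_trans (card_le_sig (B b)).
    apply: (@card_le_rel _ _ _ _ (fun z y => iota z = y)) => [z Bz|]; first by exists (iota z).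
    by move=> z z' y _ _ <- /esym /iota_inj.
  - apply: small_bigcup => // [|a ab]; first exact: card_le_trans (card_leT _) (smA b).
    apply: card_le_trans (pset_small (t a)) _; apply: card_le_trans (card_sig_le _) _.
    by apply: card_le_trans (card_le_sig _); exact: subset_card_le (monoB ab).
  - apply: small_bigcup => // a _; apply: card_le_trans (card_le_sig (B b)).
    have [_ inj] := enP _ a (pset_small (t a)).
    apply: (@card_le_rel _ _ _ _ (fun z y => en (pset (t a)) a z = y)) => [z [_ Bz]|].
      by exists (en (pset (t a)) a z).
    by move=> z z' y [h _] [h' _] <- /esym; exact: inj.
  - by apply: small_bigcup => // a _; apply: demand_small; exact: pset_small.
have nextP t : exists t' : forall a, pos (F a),
    forall a, move (t a) (t' a) /\ need t a `<=` pset (t' a).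
  apply: (@dep_choice A (fun a => pos (F a))
    (fun a t' => move (t a) t' /\ need t a `<=` pset t')) => a.
  by have [t' h1 h2] := reply (t a) (needP t a); exists t'.
have [next {}nextP] := choice nextP.
exists (fun n => iter n next (fun a => start (F a))) => P; split=> //.
- by move=> n a; exact: (nextP _ a).1.
- by move=> n a b z dz; apply: (nextP _ b).2; do 3!right; exists a.
split.
- move=> a b ab z [n _ az]; exists n.+1 => //; apply: (nextP _ b).2.
  by right; left; exists a.
- apply/seteqP; split=> // z _; have [a az] := coverB (iota z).
  by exists a => //; exists 1 => //; apply: (nextP _ a).2; left.
- move=> a exb lim z [n _ az]; set t := iter n _ _ in az.
  have [h _] := enP _ a (pset_small (t a)); have [b ba bz] := contB exb lim (h z az).
  exists b => //; exists n.+1 => //; apply: (nextP _ b).2.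
  by do 2!right; left; exists a.
Qed.

End Interleaving.

Lemma strict_wo_nat : strict_wo (fun n k : nat => (n < k)%N).
Proof.
split; last first.
- by move=> n k; case: (ltngtP n k) => h; [constructor 1|constructor 3|constructor 2].
- by move=> x y z xy yz; exact: ltn_trans xy yz.
by move=> n; elim/ltn_ind: n => n IH; constructor=> k; exact: IH.
Qed.

(** * Strategies from DD-projectivity and from strong sets *)

Section Strategies.
Variables (R : rngType) (hR : enough_idempotents R).
Variables (X Y : Type) (e : X -> R) (rel : Y -> seq (X * R)).
Variables (M : rmodType R) (m : X -> M).
Hypotheses (M_unitary : unitary M) (e_idem : forall k, idempotent_elt (e k)).
Hypothesis M_pres : presents e rel m.
Variable DD : rmodType R -> Prop.
Hypothesis DD_unitary : forall D, DD D -> unitary D.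

Lemma strategy_projective (W L : Type) (lt : L -> L -> Prop) :
  infinite_set [set: W] -> succ_wo W lt -> D_projective DD L M ->
  exists F : strategy (X + Y) W, forall s : nat -> pos F,
    (forall n, move (s n) (s n.+1)) ->
    lifts e rel DD (\bigcup_n pset (s n)) /\ dinj e rel DD (\bigcup_n pset (s n)) setT.
Proof.
move=> infW succL [d [I [S [c [sys cD]]]]].
pose T := {t : state X Y S | valid e rel m W c t}.
have start : T by apply: cid; exact: valid_init sys.
have small (t : T) : st_set (sval t) #<= [set: W] by have [] := svalP t.
have sub (t t' : T) : st_step e rel (sval t) (sval t') -> st_set (sval t) `<=` st_set (sval t').
  by move=> [[]].
have rep (t : T) U : U #<= [set: W] -> exists2 t' : T,
    st_step e rel (sval t) (sval t') & U `<=` st_set (sval t').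
  move=> smU; have [t' [vt' st Ut]] :=
    step_exists M_unitary e_idem M_pres infW succL sys (svalP t) smU.
  by exists (exist _ t' vt').
exists (Strategy start small sub rep) => /= s steps.
have le n k : (n <= k)%N -> st_le (sval (s n)) (sval (s k)).
  elim: k => [|k IH]; first by rewrite leqn0 => /eqP->; exact: st_le_refl.
  rewrite leq_eqVlt => /orP[/eqP->|nk]; first exact: st_le_refl.
  exact: st_le_trans (IH nk) (steps k).1.
have st n k : [set: nat] n -> [set: nat] k -> (n < k)%N -> st_step e rel (sval (s n)) (sval (s k)).
  by move=> _ _ nk; exact: st_step_le (steps n) (le _ _ nk).
have v n : [set: nat] n -> valid e rel m W c (sval (s n)) by move=> _; exact: svalP.
have ne : [set: nat] !=set0 by exists 0.
have nomax n : [set: nat] n -> exists2 k, [set: nat] k & (n < k)%N by exists n.+1.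
split.
  exact: (chain_lifts DD_unitary infW succL sys strict_wo_nat (small_nat infW) v ne nomax st).
exact: (chain_dinj M_pres DD_unitary infW succL sys strict_wo_nat (small_nat infW) v ne nomax st).
Qed.

Variables (A : Type) (W : A -> Type).
Hypothesis infW : forall a, infinite_set [set: W a].

(** x is a model of P and of V separately; relations mixing letters of both are obtained only
    through the extension y. *)
Definition extends (P V P' : set (X + Y)) : Prop :=
  forall D, DD D -> forall x : X -> D, model e rel P x -> model e rel V x ->
    exists y : X -> D, [/\ model e rel P' y, agree P x y & agree V x y].

(* A position carries, besides a strong set, the closure demands that were
   imposed on the smaller sets in order that they DD-inject into it. *)
Record position (a : A) := Position {
  pos_set : set (X + Y);
  pos_demand : A -> set (X + Y) -> set (X + Y);
  pos_strong : strong e rel DD (W a) pos_set;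
  pos_demand_small : forall b V, V #<= [set: W b] -> pos_demand b V #<= [set: W b]
}.

(** Demands only grow, so sets obeying later demands also obey all earlier ones. *)
Definition pos_move (a : A) (t t' : position a) : Prop :=
  [/\ pos_set t `<=` pos_set t',
      forall b V, pos_demand t b V `<=` pos_demand t' b V
    & forall b (Yn : nat -> set (X + Y)), (forall n, Yn n #<= [set: W b]) ->
        (forall n, pos_demand t' b (Yn n) `<=` Yn n.+1) ->
        extends (pos_set t) (\bigcup_n (Yn n `&` pos_set t')) (pos_set t')].

Hypothesis DD_closed : filter_closed DD.
Hypothesis strong_cof : forall a (U : set (X + Y)), U #<= [set: W a] ->
  exists2 P, U `<=` P & strong e rel DD (W a) P.

(** The empty start lets the recursion in [position_dinj] begin with the zero function. *)
Lemma position_start a : exists t : position a, pos_set t = set0.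
Proof.
have s0 : strong e rel DD (W a) set0.
  by split=> [||P' _]; [exact: card_ge0|exact: lifts_set0|exact: dinj_set0].
have d0 b (V : set (X + Y)) : V #<= [set: W b] -> (set0 : set (X + Y)) #<= [set: W b].
  by move=> _; exact: card_ge0.
by exists (@Position a set0 (fun _ _ => set0) s0 d0).
Qed.

(** A strong set P' above U and the old set P lifts, and P DD-injects into it, so [filter_club]
    applies to the pair for each size W b; the resulting operations are the new demands. Sets are
    cut down to P' first, since finite stages of smaller indices need not lie in P'. *)
Lemma position_reply a (t : position a) (U : set (X + Y)) : U #<= [set: W a] ->
  exists2 t', pos_move t t' & U `<=` pos_set t'.
Proof.
move=> smU; have [smP _ dP] := pos_strong t.
have [P' sub str] := strong_cof (small_setU (@infW a) smU smP).
have [smP' lP' _] := str.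
have PP' : pos_set t `<=` P' by move=> z Pz; apply: sub; right.
have clubP b := filter_club hR e_idem DD_closed (@infW b) PP' lP' (dP P' smP').
have {clubP} [club clubP] := choice clubP.
pose dem b V := pos_demand t b V `|` club b (V `&` P').
have demS b V : V #<= [set: W b] -> dem b V #<= [set: W b].
  move=> smV; apply: small_setU => //; first exact: pos_demand_small.
  by have [h _ _] := clubP b; apply: h; apply: small_subset smV => z [].
exists (Position str demS); last by move=> z Uz; apply: sub; left.
split=> //= [b V z|b Yn smY dY]; first by left.
move=> D DDD x mx mV; have [h1 h2 h3] := clubP b.
apply: (h3 (fun n => Yn n `&` P')) => // n.
  by apply: (small_subset _ (smY n)) => z [].
by move=> z cz; split; [apply: dY; right|exact: h2 cz].
Qed.

(** The extension of x is built along s: a model on [s n] that agrees with x on V inside [s n] is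
    extended to [s n.+1] with x prescribed on V there, by the third clause of [pos_move]. *)
Lemma position_dinj (a b : A) (s : nat -> position a) (r : nat -> position b) :
  pos_set (s 0) = set0 -> (forall n, pos_move (s n) (s n.+1)) ->
  (forall n, pos_move (r n) (r n.+1)) ->
  (forall n, pos_demand (s n) b (pos_set (r n)) `<=` pos_set (r n.+1)) ->
  \bigcup_n pos_set (r n) `<=` \bigcup_n pos_set (s n) ->
  dinj e rel DD (\bigcup_n pos_set (r n)) (\bigcup_n pos_set (s n)).
Proof.
move=> s0 ms mr dem sub; set V := \bigcup_n pos_set (r n).
have mono (c : A) (q : nat -> position c) : (forall n, pos_move (q n) (q n.+1)) ->
    forall n k, (n <= k)%N -> pos_set (q n) `<=` pos_set (q k) /\
      forall b V, pos_demand (q n) b V `<=` pos_demand (q k) b V.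
  move=> mq n; elim=> [|k IH]; first by rewrite leqn0 => /eqP->; split=> // b' V' z.
  rewrite leq_eqVlt => /orP[/eqP->|/IH[h1 h2]]; first by split=> // b' V' z.
  have [h3 h4 _] := mq k.
  by split=> [z /h1/h3|b' V' z /h2/h4].
move=> D DDD x mx.
have [wfn _ _] := strict_wo_nat.
have [|||f fP] := @wf_dependent_choice nat (X -> D) (fun n k => (n < k)%N)
  (fun n f y => [/\ model e rel (pos_set (s n)) y, agree (V `&` pos_set (s n)) x y &
    forall k, (k < n)%N -> agree (pos_set (s k)) (f k) y]) wfn.
- exact: inhabits (fun=> 0).
- by move=> n f g y fg [h1 h2 h3]; split=> // k kn; rewrite -fg //; exact: h3.
- move=> [|n] f IH.
    by exists (fun=> 0); rewrite s0; split=> // k [].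
  have [my xy h] := IH n (ltnSn n).
  pose x' k := if pselect (pos_set (s n) (inl k)) then f n k else x k.
  have ag1 : agree (pos_set (s n)) (f n) x' by move=> k nk; rewrite /x'; case: pselect.
  have ag2 : agree V x x'.
    by move=> k Vk; rewrite /x'; case: pselect => // nk; exact: xy.
  have [_ _ ext] := ms n.
  (* r obeys the demands of [s n.+1] only from n.+1 on, hence the shift; as r increases, the tail
     still has union V. *)
  pose Yn j := pos_set (r (n.+1 + j)%N).
  have YE : \bigcup_j (Yn j `&` pos_set (s n.+1)) = V `&` pos_set (s n.+1).
    apply/seteqP; split=> z; first by move=> [j _ [rz sz]]; split=> //; exists (n.+1 + j)%N.
    move=> [[j _ jz] sz]; exists j => //; split=> //.
    by apply: (mono _ _ mr j _ _).1 jz; exact: leq_addl.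
  have [|j|||y [my' a1 a2]] := ext b Yn _ _ D DDD x'.
  + by move=> j; have [] := pos_strong (r (n.+1 + j)%N).
  + rewrite /Yn addnS; apply: subset_trans (dem _).
    exact: (mono _ _ ms _ _ (leq_addr _ _)).2.
  + exact: model_agree ag1 my.
  + rewrite YE; apply: (@model_agree _ _ _ _ _ _ _ x); first by move=> k [Vk _]; exact: ag2.
    by apply: model_sub mx => z [].
  exists y; split=> // [k [Vk sk]|k kn].
    by rewrite (ag2 k Vk); apply: a2; rewrite YE.
  have ag3 : agree (pos_set (s n)) (f n) y by exact: agree_trans ag1 a1.
  move: kn; rewrite ltnS leq_eqVlt => /orP[/eqP-> //|kn].
  apply: agree_trans (h k kn) _; apply: agree_sub ag3.
  exact: (mono _ _ ms _ _ (ltnW kn)).1.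
have [||n k _ _ nk|y my yf] := @model_glue _ _ _ e rel nat _ (fun n => pos_set (s n)) setT D f
  strict_wo_nat.
- by move=> n k nk; exact: (mono _ _ ms _ _ (ltnW nk)).1.
- by move=> n _; have [] := fP n.
- by have [_ _] := fP k; exact.
exists y => // k Vk; have [n _ nk] := sub _ Vk.
by rewrite -(yf n Logic.I k nk); have [_ + _] := fP n; apply; split.
Qed.

Lemma position_lifts (a : A) (s : nat -> position a) :
  (forall n, pos_move (s n) (s n.+1)) -> lifts e rel DD (\bigcup_n pos_set (s n)).
Proof.
move=> ms; apply: (lifts_chain strict_wo_nat).
- move=> n k; elim: k => // k IH; rewrite ltnS leq_eqVlt => /orP[/eqP->|/IH h].
    by have [] := ms k.
  by apply: subset_trans h _; have [] := ms k.
- by move=> n; have [] := pos_strong (s n).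
- by move=> n k _; have [_ _] := pos_strong (s n); apply; have [] := pos_strong (s k).
- by move=> [|n] [k kn] lim //; have [j h1 h2] := lim n (ltnSn n); move: h2; rewrite ltnS leqNgt h1.
Qed.

End Strategies.

Theorem lemma6p1 (R : rngType) (hR : enough_idempotents R)
    (K : Type) (K_singular : singular K)
    (M : rmodType R) (M_unitary : unitary M) (M_pres : le_presented K M)
    (DD : rmodType R -> Prop) (DD_unitary : forall D, DD D -> unitary D)
    (N : Type) (N_infinite : infinite_set [set: N]) (N_lt_K : card_lt N K) :
  (filter_closed DD ->
   (forall L : Type, successor_cardinal L -> card_lt N L -> card_lt L K ->
      almost_D_projective DD L M) ->
   forall D, DD D -> Ext1_eq0 M D)
  /\
  ((forall L : Type, successor_cardinal L -> card_lt N L -> card_lt L K ->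
      D_projective DD L M) ->
   forall D, DD D -> Ext1_eq0 M D).
Proof.
have [X [Y [e [rel [m [sX sY e_idem pres]]]]]] := presented_presents M_pres.
have infK : infinite_set [set: K] by have [] := K_singular.
have [A [la [B [wo monoB coverB sizeB contB]]]] := singular_filtration K_singular N_infinite N_lt_K.
pose W a := {y | B a y}.
have NW a : [set: N] #<= [set: W a] by have [] := sizeB a.
have infW a : infinite_set [set: W a].
  by move=> fW; apply: N_infinite; exact: card_le_finite (NW a) fW.
have WK a : card_lt (W a) K by have [] := sizeB a.
have smA a : [set: A] #<= [set: W a] by have [] := sizeB a.
have [iota iota_inj] : exists iota : X + Y -> K, injective iota.
  have le : [set: X + Y] #<= [set: K].
    have -> : [set: X + Y] = inl @` [set: X] `|` inr @` [set: Y].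
      by apply/seteqP; split=> // z _; case: z => z; [left; exists z|right; exists z].
    by apply: small_setU => //; [exact: small_image sX|exact: small_image sY].
  have [y _] := infinite_setN0 infK.
  by have [f [_ inj]] := card_le_fun le (inhabits y); exists f => u v; exact: inj.
have succ U : infinite_set [set: U] -> [set: N] #<= [set: U] -> card_lt U K ->
    exists (L : Type) (lt : L -> L -> Prop),
      [/\ succ_wo U lt, successor_cardinal L, card_lt N L & card_lt L K].
  move=> infU NU UK; have [L [lt [sL LK]]] := singular_succ K_singular infU UK.
  exists L, lt; split=> //; first exact: succ_wo_successor sL.
  have [UL nLU] := succ_wo_lt sL; split; first exact: card_le_trans NU UL.
  by move=> LN; apply: nLU; exact: card_le_trans LN NU.
split=> [DD_closed|] proj.
  have cof a (U : set (X + Y)) : U #<= [set: W a] ->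
      exists2 P, U `<=` P & strong e rel DD (W a) P.
    have [L [lt [sL scL NL LK]]] := succ _ (infW a) (NW a) (WK a).
    have infL := succ_wo_infinite (infW a) sL.
    (* The second successor of |W a| is below K as well, again because K is a limit cardinal. *)
    have [L2 [lt2 [sL2 scL2 NL2 L2K]]] := succ L infL NL.1 LK.
    have [d [I [S [c sys]]]] := proj L scL NL LK.
    have [d2 [I2 [S2 [c2 sys2]]]] := proj L2 scL2 NL2 L2K.
    exact: (strong_cofinal hR M_unitary e_idem pres DD_unitary DD_closed (infW a) sL sL2 sys sys2).
  have [st st0] := dep_choice (position_start e rel DD W).
  pose F a := Strategy (st a)
    (fun t => let: And3 h _ _ := pos_strong t in h)
    (fun t t' (mv : pos_move t t') => let: And3 h _ _ := mv in h)
    (position_reply hR e_idem infW DD_closed cof (a := a)).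
  have [t [t0 tm td [Pm Pc Pl]]] := interleave infW monoB coverB smA contB iota_inj
    (F := F) (fun a => @pos_demand_small _ _ _ _ _ _ _ _ a).
  apply: (lifts_Ext1_eq0 M_unitary DD_unitary pres); rewrite -Pc.
  apply: (lifts_chain wo) => // [a|b a ba].
    exact: (position_lifts (s := fun n => t n a) (fun n => tm n a)).
  apply: (position_dinj (s := fun n => t n a) (r := fun n => t n b)) => [|n|n|n|].
  - by rewrite t0.
  - exact: tm.
  - exact: tm.
  - exact: td.
  - exact: Pm.
have stratP a : exists F : strategy (X + Y) (W a), forall s : nat -> pos F,
    (forall n, move (s n) (s n.+1)) ->
    lifts e rel DD (\bigcup_n pset (s n)) /\ dinj e rel DD (\bigcup_n pset (s n)) setT.
  have [L [lt [sL scL NL LK]]] := succ _ (infW a) (NW a) (WK a).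
  exact: (strategy_projective M_unitary e_idem pres DD_unitary (infW a) sL (proj L scL NL LK)).
have [F FP] := dep_choice stratP.
have [|t [_ tm _ [Pm Pc Pl]]] := interleave infW monoB coverB smA contB iota_inj
  (F := F) (demand := fun _ _ _ _ => set0).
  by move=> *; exact: card_ge0.
apply: (lifts_Ext1_eq0 M_unitary DD_unitary pres); rewrite -Pc.
apply: (lifts_chain wo) => // [a|b a ba].
  exact: (FP a _ (fun n => tm n a)).1.
(* An extension to all generators and relations restricts to P a. *)
apply: (@dinj_sub _ _ _ _ _ _ _ setT) => //.
exact: (FP b _ (fun n => tm n b)).2.
Qed.
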